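(* Let $0<q<1$ and $t>0$. Let $(J^*,\mathcal D^* )$ be the adjoint of the operator $(J,\mathcal D)$ on $\ell^2(\mathbb Z)$ given by $$Je_k=a_ke_{k+1}+b_ke_k+a_{k-1}e_{k-1},\qquad a_k=\frac1{\sqrt{tq^{k+1}}},\quad b_k=-\frac1{tq^k},\qquad k\in\mathbb Z.$$ Then the spectrum of $J^*$ is $$\sigma(J^* )=\{-q^r/t\mid r\in\mathbb Z\}\cup\{0\}\cup\{q^n\mid n\in\mathbb Z_+\},$$ and the accumulation point $0$ does not belong to the point spectrum of $J^*$.
   Context: $\{e_k\}_{k\in\mathbb Z}$ is the standard orthonormal basis of $\ell^2(\mathbb Z)$, $\mathcal D$ is the space of finite linear combinations of the $e_k$, and $\mathbb Z_+=\{0,1,2,\dots\}$. $(J,\mathcal D)$ is essentially self-adjoint, so $J^*$ is self-adjoint and equals the closure of $J$; it acts by $(J^*v)_k=a_kv_{k+1}+b_kv_k+a_{k-1}v_{k-1}$ on $\mathcal D^*=\{v\in\ell^2(\mathbb Z):\sum_{k}|a_kv_{k+1}+b_kv_k+a_{k-1}v_{k-1}|^2<\infty\}$. The point spectrum is the set of eigenvalues. *)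

(* Defs.v *)
From HB Require Import structures.
From mathcomp Require Import all_boot all_order all_algebra.
From mathcomp Require Import all_classical all_reals all_analysis.
From mathcomp Require Export complex.

Set Implicit Arguments.
Unset Strict Implicit.
Unset Printing Implicit Defensive.

Import Order.TTheory GRing.Theory Num.Theory.
Import numFieldNormedType.Exports.

Local Open Scope classical_set_scope.
Local Open Scope ring_scope.
Local Open Scope complex_scope.

Section SequenceSpace.
Variable R : realType.
Implicit Types (u v w : int -> R[i]) (z : R[i]).

Definition sqnormZ v : \bar R :=
  (\esum_(k in [set: int]) (Normc.normc (v k) ^+ 2)%:E)%E.

Definition ell2 : set (int -> R[i]) := [set v | (sqnormZ v < +oo)%E].

Definition ell2norm v : R := Num.sqrt (fine (sqnormZ v)).

Definition partial_sumZ (f : int -> R[i]) (n : nat) : R[i] :=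
  \sum_(j < n.*2.+1) f (j%:Z - n%:Z).

(* The limit of the sums over [-n, n], taken in each coordinate; it is the sum
   of f whenever f is absolutely summable, which holds for the pointwise product
   of two elements of ell2. *)
Definition sumZ (f : int -> R[i]) : R[i] :=
  limn (fun n => complex.Re (partial_sumZ f n)) +i*
  limn (fun n => complex.Im (partial_sumZ f n)).

Definition inner u v : R[i] := sumZ (fun k => u k * (v k)^*).

Definition basisZ (k : int) : int -> R[i] := fun j => (j == k)%:R.

(* An unbounded operator T on ell2 is represented by its graph:
   T (v, w) means that v is in the domain of T and T v = w. *)
Definition operator := set ((int -> R[i]) * (int -> R[i])).

Implicit Types T : operator.

(* It is single-valued as soon as the domain of T is dense. *)
Definition adjoint T : operator :=
  [set p | [/\ ell2 p.1, ell2 p.2 &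
    forall u w, T (u, w) -> inner w p.1 = inner u p.2]].

(* T - z maps the domain of T bijectively onto ell2, with bounded inverse;
   (T - z) v = f is written T v = z v + f. *)
Definition resolvent_set T : set R[i] :=
  [set z | (forall f, ell2 f -> exists! v, T (v, z *: v + f)) /\
    exists M : R, forall v f, ell2 f -> T (v, z *: v + f) ->
      ell2norm v <= M * ell2norm f].

Definition spectrum T : set R[i] := ~` resolvent_set T.

Definition point_spectrum T : set R[i] :=
  [set z | exists2 v, v <> 0 & T (v, z *: v)].

Definition jacobi_column (a b : int -> R) (k : int) : int -> R[i] :=
  (a k)%:C *: basisZ (k + 1) + (b k)%:C *: basisZ k +
  (a (k - 1))%:C *: basisZ (k - 1).

(* The linear extension of basisZ k |-> jacobi_column a b k to the finite
   linear combinations of the vectors basisZ k. *)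
Definition jacobi (a b : int -> R) : operator :=
  [set p | exists (s : seq int) (c : int -> R[i]),
    p.1 = \sum_(k <- s) c k *: basisZ k /\
    p.2 = \sum_(k <- s) c k *: jacobi_column a b k].

End SequenceSpace.

Section Coefficients.
Variables (R : realType) (q t : R).

Definition coef_a (k : int) : R := (Num.sqrt (t * q ^ (k + 1)))^-1.
Definition coef_b (k : int) : R := - (t * q ^ k)^-1.

End Coefficients.

(* Main.v *)
Require Import Defs.
From HB Require Import structures.
From mathcomp Require Import all_boot all_order all_algebra.
From mathcomp Require Import all_classical all_reals all_analysis.
From mathcomp Require Import ring lra zify.

Set Implicit Arguments.
Unset Strict Implicit.
Unset Printing Implicit Defensive.

Import Order.TTheory GRing.Theory Num.Theory.
Import numFieldNormedType.Exports.

Local Open Scope classical_set_scope.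
Local Open Scope ring_scope.
Local Open Scope complex_scope.

(** Put s = sqrt q and A k = coef_a k.  Then
    A k = s * A (k + 1) and coef_b k = - A (k - 1) ^ 2, so the eigenvalue equation
    is A k v(k+1) - (A (k-1) ^ 2 + z) v(k) + A (k-1) v(k-1) = 0, where A k is
    a geometric sequence, tending to +oo on the right and to 0 on the left.

    If z is nonzero the diagonal dominates the off-diagonal entries at both ends.
    Hence at each end one solution, unique up to a factor, decays and all the others
    grow geometrically.  If no nonzero solution is bounded at both ends, the
    solutions v and w that decay at +oo and at -oo have a nonzero Casoratian, and
    v and w build a Green's function that decays exponentially away from the
    diagonal (green_kernel); by Schur's test it inverts J* - z boundedly
    (solve_of_kernel, mem_resolvent_set).  So a nonzero z is in the spectrum
    exactly when it has a nonzero bounded eigensequence, and it remains to find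
    these z.

    The operator 1 - J is a product of two bidiagonal factors, and exchanging the
    factors gives 1 - q J up to a shift of the indices.  This yields explicit maps
    lower and raise between the eigensequences for q z and those for z, injective
    unless q z = 1.  Starting from the explicit eigensequence for 1, raising gives
    the eigenvalues q ^ n.  Conversely, if z is an eigenvalue other than the
    q ^ n, lowering shows that z / q ^ n is one for all n; a shift by n turns this
    into an eigensequence for z of the operator whose off-diagonal entries
    are multiplied by s ^ n, and for large n this operator is too diagonal to have one,
    unless z is itself a diagonal entry coef_b p = - q ^ (- p) / t
    (not_bounded_eigenvalue).  Finally each diagonal entry coef_b p is an
    eigenvalue, because the equation for z = coef_b p is symmetric about p and the
    solution that decays at +oo is its own mirror image (kernel_symmetry).

    The point 0 is in the spectrum as a limit of the eigenvalues q ^ n.  It is not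
    an eigenvalue, because for z = 0 the leading part of the equation at -oo is
    v(k-1) = - v(k+1) / s, whose solutions all grow (kernel0_bounded_left_eq0). *)

(** * Modulus and geometric convergence of complex sequences *)

Section Modulus.
Variable R : realType.
Implicit Types (x y : R[i]) (r : R).

Local Notation normc := (@Normc.normc R).

Lemma normc_ge0 x : 0 <= normc x.
Proof. by case: x => a b; exact: sqrtr_ge0. Qed.

Lemma normc_eq0 x : (normc x == 0) = (x == 0).
Proof. by apply/eqP/eqP => [/Normc.eq0_normc //|->]; exact: Normc.normc0. Qed.

Lemma normc_gt0 x : (0 < normc x) = (x != 0).
Proof. by rewrite lt0r normc_ge0 andbT normc_eq0. Qed.

Lemma le_normcB x y : normc (x - y) <= normc x + normc y.
Proof. by rewrite -[normc y]normcN; exact: le_normcD. Qed.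

Lemma ler_normc_dist x y : normc x - normc y <= normc (x - y).
Proof. by rewrite lerBlDr -{1}(subrK y x) le_normcD. Qed.

Lemma normc_real r : normc r%:C = `|r|.
Proof. by rewrite /= expr0n addr0 sqrtr_sqr. Qed.

Lemma normc_Re x : `|complex.Re x| <= normc x.
Proof.
by case: x => a b /=; rewrite -sqrtr_sqr ler_wsqrtr // lerDl sqr_ge0.
Qed.

Lemma normc_Im x : `|complex.Im x| <= normc x.
Proof.
by case: x => a b /=; rewrite -sqrtr_sqr ler_wsqrtr // lerDr sqr_ge0.
Qed.

Lemma normc_le_Re_Im x : normc x <= `|complex.Re x| + `|complex.Im x|.
Proof.
case: x => a b; rewrite -[(_ +i* _)%C]/(a +i* b).
have -> : a +i* b = a%:C + (0 +i* b) by simpc.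
apply: le_trans (le_normcD _ _) _.
by rewrite normc_real /= expr0n add0r sqrtr_sqr add0r addr0.
Qed.

Lemma normc_sum (I : Type) (r : seq I) (P : pred I) (F : I -> R[i]) :
  normc (\sum_(i <- r | P i) F i) <= \sum_(i <- r | P i) normc (F i).
Proof.
elim/big_ind2: _ => [|x r1 y r2 h1 h2|//]; first by rewrite Normc.normc0.
exact: le_trans (le_normcD _ _) (lerD h1 h2).
Qed.

Lemma pow_small (rho e : R) : 0 <= rho < 1 -> 0 < e -> exists n, rho ^+ n < e.
Proof.
move=> /andP[r0 r1] e0.
have /cvgrPdist_lt/(_ e e0)[N _ /(_ N (leqnn N))] : rho ^+ n @[n --> \oo] --> 0.
  by apply: cvg_expr; rewrite ger0_norm.
by rewrite sub0r normrN ger0_norm ?exprn_ge0 //; exists N.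
Qed.

Lemma le0_of_pow (rho x B : R) m : 0 <= rho < 1 ->
  (forall n, (m <= n)%N -> x <= B * rho ^+ n) -> x <= 0.
Proof.
move=> hr h; rewrite leNgt; apply/negP => x0.
have /andP[r0 r1] := hr.
have p0 n : 0 <= rho ^+ n by exact: exprn_ge0.
have B0 : 0 < B.
  by have := h _ (leqnn m); have := p0 m; case: (ltrP 0 B) => // hB h1 h2; nra.
have [n hn] := pow_small hr (divr_gt0 x0 B0).
have := h _ (leq_maxl m n).
have : rho ^+ maxn m n <= rho ^+ n by apply: ler_wiXn2l; rewrite ?leq_maxr // ltW.
move=> /(ler_wpM2l (ltW B0)); move: hn; rewrite ltr_pdivlMr //; lra.
Qed.

Lemma le0_of_half_pow (x B : R) m :
  (forall n, (m <= n)%N -> x <= B * 2^-1 ^+ n) -> x <= 0.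
Proof. by apply: le0_of_pow; lra. Qed.

(** The sequence u n - 2 B 2^-n is nondecreasing, so its supremum is the limit
    of u, with an explicit rate. *)
Lemma real_geometric_cvg (u : nat -> R) (B : R) :
  (forall n, `|u n.+1 - u n| <= B * 2^-1 ^+ n) ->
  exists l, forall n, `|u n - l| <= 2 * B * 2^-1 ^+ n.
Proof.
move=> hu.
have step n k : `|u (n + k)%N - u n| <= 2 * B * 2^-1 ^+ n - 2 * B * 2^-1 ^+ (n + k).
  elim: k => [|k IH]; first by rewrite addn0 !subrr normr0.
  rewrite addnS; have -> : u (n + k).+1 - u n = (u (n + k).+1 - u (n + k)%N) + (u (n
    + k)%N - u n) by ring.
  apply: le_trans (ler_normD _ _) _.
  apply: le_trans (lerD (hu _) IH) _.
  by rewrite exprS; lra.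
have bnd n k : `|u (n + k)%N - u n| <= 2 * B * 2^-1 ^+ n.
  have hB : 0 <= B by have := hu 0%N; rewrite expr0 mulr1; exact: le_trans.
  apply: le_trans (step n k) _; rewrite lerBlDr lerDl.
  by rewrite !mulr_ge0 ?exprn_ge0.
pose a n := u n - 2 * B * 2^-1 ^+ n.
have B0 : 0 <= B by have := hu 0%N; rewrite expr0 mulr1; exact: le_trans.
have an k n : a k <= u n + 2 * B * 2^-1 ^+ n.
  have p0 m : 0 <= (2^-1 : R) ^+ m by exact: exprn_ge0.
  rewrite /a; case: (leqP n k) => [nk|/ltnW kn].
    have := bnd n (k - n)%N; rewrite subnKC // ler_norml => /andP[_].
    have := mulr_ge0 B0 (p0 k); lra.
  have := bnd k (n - k)%N; rewrite subnKC // ler_norml => /andP[].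
  have := mulr_ge0 B0 (p0 n); lra.
exists (sup (range a)) => n; rewrite ler_norml; apply/andP; split.
  rewrite lerBrDl -lerBrDr opprK; apply: ge_sup; first by exists (a 0%N), 0%N.
  by move=> _ [k _ <-]; exact: an.
suff : a n <= sup (range a) by rewrite /a; lra.
apply: ub_le_sup; last by exists n.
by exists (u 0%N + 2 * B * 2^-1 ^+ 0) => _ [k _ <-]; exact: an.
Qed.

Lemma complex_geometric_cvg (u : nat -> R[i]) (B : R) :
  (forall n, normc (u n.+1 - u n) <= B * 2^-1 ^+ n) ->
  exists l, forall n, normc (u n - l) <= 4 * B * 2^-1 ^+ n.
Proof.
move=> hu.
have ReB x y : complex.Re (x - y) = complex.Re x - complex.Re y by case: x y => ? ? [].
have ImB x y : complex.Im (x - y) = complex.Im x - complex.Im y by case: x y => ? ? [].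
have [n|x hx] := @real_geometric_cvg (fun n => complex.Re (u n)) B.
  by rewrite -ReB; apply: le_trans (normc_Re _) (hu n).
have [n|y hy] := @real_geometric_cvg (fun n => complex.Im (u n)) B.
  by rewrite -ImB; apply: le_trans (normc_Im _) (hu n).
exists (x +i* y) => n; apply: le_trans (normc_le_Re_Im _) _.
rewrite ReB ImB /=; move: (hx n) (hy n); lra.
Qed.

End Modulus.

(** * Three-term recurrences on a half-line with dominant diagonal *)

Lemma bounded_of_eventually_bounded (R : realType) (u : nat -> R) B m :
  (forall n, (m <= n)%N -> u n <= B) -> exists B', forall n, u n <= B'.
Proof.
elim: m B => [|m IH] B h; first by exists B => n; exact: h.
apply: (IH (Num.max B (u m))) => n.
rewrite leq_eqVlt le_max => /orP[/eqP <-|mn]; first by rewrite lexx orbT.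
by rewrite h.
Qed.

Section HalfLine.
Variable R : realType.
Local Notation C := R[i].
Local Notation normc := (@Normc.normc R).

(** The recurrence starts at the second equation: the value x 0 plays the
    role of a boundary condition, so that half_sol has a two-dimensional
    space of solutions. *)
Definition half_sol (a b x : nat -> C) :=
  forall n, a n.+1 * x n.+2 + b n.+1 * x n.+1 + a n * x n = 0.

Definition bounded_seq (x : nat -> C) := exists B, forall n, normc (x n) <= B.

Variables (a b : nat -> C).
Hypothesis a_neq0 : forall n, a n != 0.
Hypothesis dom : forall n, 2 * (normc (a n.+1) + normc (a n)) <= normc (b n.+1).

Implicit Types x y : nat -> C.

Lemma half_sol_exists u v : exists x, [/\ half_sol a b x, x 0%N = u & x 1%N = v].
Proof.
pose next n (p : C * C) := (p.2, - (b n.+1 * p.2 + a n * p.1) / a n.+1).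
pose p := fix p n := if n is m.+1 then next m (p m) else (u, v).
exists (fun n => (p n).1); split=> // n /=.
by rewrite mulrC divfK //; ring.
Qed.

Lemma half_sol_next_le x n : half_sol a b x ->
  normc (b n.+1) * normc (x n.+1) <= normc (a n.+1) * normc (x n.+2) + normc (a n) *
    normc (x n).
Proof.
move=> /(_ n) h; rewrite -!Normc.normcM.
have -> : b n.+1 * x n.+1 = - (a n.+1 * x n.+2) - a n * x n.
  by apply/eqP; rewrite -subr_eq0 -h; apply/eqP; ring.
by apply: le_trans (le_normcB _ _) _; rewrite normcN.
Qed.

(** When the diagonal coefficient outweighs both neighbours, a solution that
    has started to grow cannot stop: in the equation, only the next value can
    balance the diagonal term. *)
Lemma half_sol_grow x n : half_sol a b x -> normc (x n) <= normc (x n.+1) ->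
  2 * normc (x n.+1) <= normc (x n.+2) /\
  normc (b n.+1) * normc (x n.+1) <= 2 * (normc (a n.+1) * normc (x n.+2)).
Proof.
move=> sx le1; have h := half_sol_next_le n sx.
have a1 : 0 < normc (a n.+1) by rewrite normc_gt0.
have a0 : 0 < normc (a n) by rewrite normc_gt0.
have x1 := normc_ge0 (x n.+1); have x2 := normc_ge0 (x n.+2).
have x0 := normc_ge0 (x n).
have hd := dom n.
move: (normc (a n.+1)) (normc (a n)) (normc (b n.+1)) (normc (x n)) (normc (x n.+1))
  (normc (x n.+2)) h le1 a1 a0 x1 x2 x0 hd => A1 A0 B1 X0 X1 X2 h le1 a1 a0 x1 x2 x0 hd.
split; last by nra.
have : A1 * (2 * X1) <= A1 * X2 by nra.
by rewrite ler_pM2l.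
Qed.

Lemma half_sol_grow_iter x n k : half_sol a b x -> normc (x n) <= normc (x n.+1) ->
  2 ^+ k * normc (x n.+1) <= normc (x (n.+1 + k)%N) /\
  2 * normc (x (n.+1 + k)%N) <= normc (x (n.+2 + k)%N).
Proof.
move=> sx le1; elim: k => [|k [IH1 IH2]].
  by rewrite !addn0 expr0 mul1r; split=> //; exact: (half_sol_grow sx le1).1.
rewrite !addnS; split; first by rewrite exprS -mulrA; apply: le_trans IH2; lra.
apply: (half_sol_grow sx _).1; apply: le_trans IH2.
by have := normc_ge0 (x (n.+1 + k)%N); lra.
Qed.

(** A bounded solution never starts to grow, because growth would then be
    geometric; hence it is nonincreasing, and in the equation only the previous
    value is left to balance the diagonal term. *)
Lemma bounded_half_sol_decay x n : half_sol a b x -> bounded_seq x ->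
  normc (x n.+1) <= 2^-1 * normc (x n) /\
  normc (b n.+1) * normc (x n.+1) <= 2 * (normc (a n) * normc (x n)).
Proof.
move=> sx [B hB].
have dec m : normc (x m.+1) <= normc (x m).
  rewrite leNgt; apply/negP => lt1.
  have x1 : 0 < normc (x m.+1) by apply: le_lt_trans lt1; exact: normc_ge0.
  suff : normc (x m.+1) <= 0 by rewrite leNgt x1.
  apply: (@le0_of_half_pow _ _ B 0%N) => k _.
  have [h _] := half_sol_grow_iter k sx (ltW lt1).
  rewrite exprVn ler_pdivlMr ?exprn_gt0 // mulrC.
  exact: le_trans h (hB _).
have h := half_sol_next_le n sx.
have a1 : 0 < normc (a n.+1) by rewrite normc_gt0.
have a0 : 0 < normc (a n) by rewrite normc_gt0.
have x1 := normc_ge0 (x n.+1).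
have hd := dom n; move: (dec n.+1).
move: (normc (a n.+1)) (normc (a n)) (normc (b n.+1)) (normc (x n)) (normc (x n.+1))
  (normc (x n.+2)) h a1 a0 x1 hd => A1 A0 B1 X0 X1 X2 h a1 a0 x1 hd le2.
have k : B1 * X1 <= 2 * (A0 * X0) by nra.
split=> //.
have : A0 * (2 * X1) <= A0 * X0 by nra.
by rewrite ler_pM2l //; lra.
Qed.

Lemma half_sol_dichotomy x : half_sol a b x -> bounded_seq x \/
  exists m, forall n, (m <= n)%N -> 2 * normc (x n) <= normc (x n.+1).
Proof.
move=> sx; have [[m hm]|h] := pselect (exists m, normc (x m) <= normc (x m.+1)).
  right; exists m.+1 => n mn.
  have [_] := half_sol_grow_iter (n - m.+1) sx hm.
  have -> : (m.+1 + (n - m.+1) = n)%N by lia.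
  by have -> : (m.+2 + (n - m.+1) = n.+1)%N by lia.
left; exists (normc (x 0%N)); elim=> // n IH; apply: le_trans IH.
by apply/ltW; rewrite ltNge; apply/negP => k; apply: h; exists n.
Qed.

(** The discrete analogue of the Wronskian. *)
Definition half_casoratian x y n := a n * (x n * y n.+1 - x n.+1 * y n).

Lemma half_casoratian_const x y n : half_sol a b x -> half_sol a b y ->
  half_casoratian x y n = half_casoratian x y 0.
Proof.
move=> sx sy; elim: n => // n <-; rewrite /half_casoratian.
have := sx n; have := sy n => ey ex; apply/eqP; rewrite -subr_eq0; apply/eqP.
transitivity (x n.+1 * (a n.+1 * y n.+2 + b n.+1 * y n.+1 + a n * y n)
  - y n.+1 * (a n.+1 * x n.+2 + b n.+1 * x n.+1 + a n * x n)); first by ring.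
by rewrite ex ey !mulr0 subr0.
Qed.

Variable d : R.
Hypothesis d_gt0 : 0 < d.
Hypothesis b_ge : forall n, d <= normc (b n.+1).

(** This is the bound on the diagonal of the Green's function. If y is
    bounded there is nothing to do; otherwise y doubles while x halves, the
    first product in the constant Casoratian dominates the second one, and
    a n * x n * y n.+1 is bounded; the lower bound on b turns this into a bound
    on x n * y n. *)
Lemma half_sol_product_bounded x y : half_sol a b x -> bounded_seq x ->
  half_sol a b y -> exists B, forall n, normc (x n) * normc (y n) <= B.
Proof.
move=> sx bx sy.
have dx n := (bounded_half_sol_decay n sx bx).1.
have [[B hB]|[m hm]] := half_sol_dichotomy sy.
  case: bx => B' hB'; exists (B' * B) => n; apply: ler_pM => //; exact: normc_ge0.
pose W := normc (half_casoratian x y 0).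
have key n : (m <= n)%N -> normc (x n.+1) * normc (y n.+1) <= 8 / (3 * d) * W.
  move=> mn; have [_ h2] := bounded_half_sol_decay n sx bx.
  have hW : normc (a n) * (normc (x n) * normc (y n.+1) - normc (x n.+1) * normc (y
    n)) <= W.
    rewrite /W -(half_casoratian_const n sx sy) /half_casoratian Normc.normcM.
    rewrite ler_wpM2l ?normc_ge0 // -!Normc.normcM; exact: ler_normc_dist.
  move: hW h2 (hm _ mn) (dx n) (b_ge n) (normc_ge0 (x n.+1)) (normc_ge0 (y n))
    (normc_ge0 (x n)) (normc_ge0 (y n.+1)) (normc_ge0 (a n)).
  move: (normc (a n)) (normc (b n.+1)) (normc (x n)) (normc (x n.+1)) (normc (y n))
    (normc (y n.+1)) => A B1 X0 X1 Y0 Y1 hW h2 hy hx hb X1p Y0p X0p Y1p Ap.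
  rewrite mulrAC ler_pdivlMr ?mulr_gt0 //.
  have s1 : X1 * Y0 <= X0 * Y1 / 4.
    have : X1 * Y0 <= (2^-1 * X0) * (Y1 / 2) by apply: ler_pM => //; lra.
    by lra.
  have s2 : A * (X0 * Y1) * 3 <= 4 * W.
    have := ler_wpM2l Ap s1; lra.
  have s3 : d * (X1 * Y1) <= 2 * (A * (X0 * Y1)).
    have t1 : d * (X1 * Y1) <= B1 * (X1 * Y1) by rewrite ler_wpM2r ?mulr_ge0.
    have := ler_wpM2r Y1p h2; lra.
  lra.
apply: (@bounded_of_eventually_bounded _ _ (8 / (3 * d) * W) m.+1).
by case=> // n; exact: key.
Qed.

(** Take the solutions s and p with initial values (0, 1) and (1, 0). The
    solution s doubles at each step, and the constancy of the Casoratian makes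
    the increments of p / s of the order of s ^ -2; so p / s converges to some l,
    with an error of that order, and p - l s is bounded by a multiple of
    1 / s. *)
Lemma exists_bounded_half_sol : exists x,
  [/\ half_sol a b x, bounded_seq x & x 0%N = 1].
Proof.
have [s [ss s0 s1]] := half_sol_exists 0 1.
have [p [sp p0 p1]] := half_sol_exists 1 0.
have gr k : 2 ^+ k <= normc (s k.+1) /\ d * normc (s k.+1) <= 2 * (normc (a k.+1) *
  normc (s k.+2)).
  have h0 : normc (s 0%N) <= normc (s 1%N) by rewrite s0 s1 Normc.normc0 Normc.normc1.
  have [h1 h2] := half_sol_grow_iter k ss h0.
  move: h1; rewrite s1 Normc.normc1 mulr1 add1n => h1; split=> //.
  case: k {h2} h1 => [|k] _; first by apply: le_trans (half_sol_grow ss h0).2;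
    rewrite ler_wpM2r ?normc_ge0.
  have [_ h2] := half_sol_grow_iter k ss h0; rewrite !addSn add0n in h2.
  apply: (@le_trans _ _ (normc (b k.+2) * normc (s k.+2))).
    by rewrite ler_wpM2r ?normc_ge0.
  apply: (half_sol_grow ss _).2; apply: le_trans h2.
  by have := normc_ge0 (s k.+1); lra.
have spos k : 0 < normc (s k.+1) by apply: lt_le_trans (gr k).1; exact: exprn_gt0.
have snz k : s k.+1 != 0 by rewrite -normc_gt0.
pose W := normc (a 0%N).
have hW k : a k * (s k * p k.+1 - s k.+1 * p k) = - a 0%N.
  have := half_casoratian_const k ss sp; rewrite /half_casoratian => ->.
  by rewrite s0 s1 p0; ring.
pose r k := p k.+1 / s k.+1.
have rs k j : normc (r (k + j).+1 - r (k + j)%N) <=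
    2 * W / d * (normc (s k.+1) ^+ 2)^-1 * 2^-1 ^+ j.
  have -> : r (k + j).+1 - r (k + j)%N = - a 0%N / (a (k + j).+1 * s (k + j).+1 * s
    (k + j).+2).
    by rewrite -(hW (k + j).+1) /r; field; rewrite a_neq0 !snz.
  rewrite Normc.normcM normcN Normc.normcV !Normc.normcM -/W.
  have [_ h1] := gr (k + j)%N.
  have h2 : 2 ^+ j * normc (s k.+1) <= normc (s (k + j).+1).
    have h0 : normc (s k) <= normc (s k.+1).
      case: k {h1} => [|k]; first by rewrite s0 Normc.normc0 normc_ge0.
      have h0 : normc (s 0%N) <= normc (s 1%N) by rewrite s0 s1 Normc.normc0
        Normc.normc1.
      have [_ h2] := half_sol_grow_iter k ss h0; rewrite !addSn add0n in h2.
      by apply: le_trans h2; have := normc_ge0 (s k.+1); lra.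
    by have [] := half_sol_grow_iter j ss h0; rewrite addSn.
  have Wp : 0 <= W := normc_ge0 _.
  have A0 : 0 < normc (a (k + j).+1) by rewrite normc_gt0.
  have j1 : 1 <= 2 ^+ j :> R by apply: exprn_ege1; lra.
  rewrite exprVn.
  move: (spos k) (spos (k + j)%N) (spos (k + j).+1) h1 h2 A0 j1.
  move: (normc (s k.+1)) (normc (s (k + j).+1)) (normc (s (k + j).+2)) (normc (a (k +
    j).+1)) (2 ^+ j) => S0 S1 S2 A e S0p S1p S2p h1 h2 A0 e1.
  have e0 : 0 < e by lra.
  have -> : 2 * W / d * (S0 ^+ 2)^-1 * e^-1 = W * (d / 2 * (e * S0 ^+ 2))^-1.
    by field; rewrite !gt_eqF.
  rewrite ler_wpM2l // lef_pV2 ?posrE ?mulr_gt0 ?exprn_gt0 //.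
  have t1 : e * S0 ^+ 2 <= S1 ^+ 2.
    have t2 : (e * S0) * (e * S0) <= S1 * S1.
      by apply: ler_pM => //; rewrite mulr_ge0 // ltW.
    have t3 : 0 <= (e - 1) * (e * (S0 * S0)).
      by rewrite mulr_ge0 ?subr_ge0 // !mulr_ge0 // ltW.
    rewrite !expr2; lra.
  have t4 := ler_wpM2r (ltW S1p) h1.
  have t5 := ler_wpM2l (ltW d_gt0) t1; rewrite expr2 in t5 *; lra.
have [l hl] := @complex_geometric_cvg _ r (2 * W / d * (normc (s 1%N) ^+ 2)^-1) (rs
  0%N).
have hlk k : normc (r k - l) <= 8 * W / d * (normc (s k.+1) ^+ 2)^-1.
  have rsk j : normc (r (k + j.+1)%N - r (k + j)%N) <=
      2 * W / d * (normc (s k.+1) ^+ 2)^-1 * 2^-1 ^+ j by rewrite addnS; exact: rs.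
  have [l' hl'] := @complex_geometric_cvg _ (fun j => r (k + j)%N) _ rsk.
  suff <- : l' = l by have := hl' 0%N; rewrite addn0 expr0 mulr1; lra.
  apply/eqP; rewrite -subr_eq0 -normc_eq0 eq_le normc_ge0 andbT.
  set B1 := 2 * W / d * _ in hl; set B2 := 2 * W / d * _ in hl'.
  apply: (@le0_of_half_pow _ _ (4 * B1 + 4 * B2) 0%N) => n _.
  have -> : l' - l = (r (k + n)%N - l) - (r (k + n)%N - l') by ring.
  apply: le_trans (le_normcB _ _) _; move: (hl (k + n)%N) (hl' n).
  have B10 : 0 <= B1.
    by rewrite !mulr_ge0 ?invr_ge0 ?exprn_ge0 ?normc_ge0 // ltW.
  have : (2^-1 : R) ^+ (k + n) <= 2^-1 ^+ n by apply: ler_wiXn2l; rewrite ?leq_addl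
    //; lra.
  move=> /(ler_wpM2l B10); lra.
exists (fun n => p n - l * s n); split; last by rewrite p0 s0 mulr0 subr0.
  move=> n; move: (ss n) (sp n) => e1 e2.
  transitivity ((a n.+1 * p n.+2 + b n.+1 * p n.+1 + a n * p n)
    - l * (a n.+1 * s n.+2 + b n.+1 * s n.+1 + a n * s n)); first by ring.
  by rewrite e1 e2 mulr0 subr0.
apply: (@bounded_of_eventually_bounded _ _ (8 * W / d) 1%N); case=> // k _.
have -> : p k.+1 - l * s k.+1 = (r k - l) * s k.+1.
  by rewrite /r mulrBl divfK.
rewrite Normc.normcM; apply: le_trans (ler_wpM2r (normc_ge0 _) (hlk k)) _.
have s1p : 1 <= normc (s k.+1).
  by apply: le_trans (gr k).1; apply: exprn_ege1; lra.
have W0 : 0 <= 8 * W / d by rewrite !mulr_ge0 ?invr_ge0 ?normc_ge0 // ltW.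
have -> : 8 * W / d * (normc (s k.+1) ^+ 2)^-1 * normc (s k.+1) =
    8 * W / d * (normc (s k.+1))^-1 by field; rewrite !gt_eqF.
by apply: ler_piMr => //; rewrite invf_le1.
Qed.
End HalfLine.

(** * Tridiagonal operators on two-sided sequences *)

Section Tridiagonal.
Variable R : realType.
Local Notation C := R[i].
Local Notation normc := (@Normc.normc R).
Implicit Types (alpha beta v x y : int -> C).

Definition tridiag alpha beta v k :=
  alpha k * v (k + 1) + beta k * v k + alpha (k - 1) * v (k - 1).

Definition kernel alpha beta v := forall k, tridiag alpha beta v k = 0.

Definition bounded_right v := bounded_seq (fun n => v n%:Z).

Definition bounded_left v := bounded_seq (fun n => v (- n%:Z)).

(** The off-diagonal entries are small compared with the diagonal ones near
    +oo. The condition near -oo is the same one for the reflected coefficients: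
    every statement about the left end comes from the right end through
    tridiag_reflect. *)
Definition dominant alpha beta := exists (K : nat) (d : R), 0 < d /\
  forall k, K%:Z <= k ->
    2 * (normc (alpha k) + normc (alpha (k - 1))) <= normc (beta k) /\
    d <= normc (beta k).

(** The entry alpha k couples k and k + 1, which reflection sends to - k and
    - k - 1: this is the origin of the shift by one. *)
Definition reflect_offdiag alpha := fun k : int => alpha (- k - 1).

Lemma tridiag_reflect alpha beta v k :
  tridiag (reflect_offdiag alpha) (beta \o -%R) (v \o -%R) k =
  tridiag alpha beta v (- k).
Proof.
rewrite /tridiag /reflect_offdiag /=.
have -> : - (k - 1) - 1 = - k by ring.
have -> : - (k - 1) = - k + 1 by ring.
have -> : - (k + 1) = - k - 1 by ring.
by ring.
Qed.

Lemma kernel_reflect alpha beta v : kernel alpha beta v ->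
  kernel (reflect_offdiag alpha) (beta \o -%R) (v \o -%R).
Proof. by move=> h k; rewrite tridiag_reflect. Qed.

Lemma kernel_half alpha beta v (K : int) : kernel alpha beta v ->
  half_sol (fun n => alpha (K + n%:Z)) (fun n => beta (K + n%:Z))
    (fun n => v (K + n%:Z)).
Proof.
move=> h n; have := h (K + n.+1%:Z); rewrite /tridiag.
have -> : K + n.+1%:Z - 1 = K + n%:Z by lia.
by have -> : K + n.+1%:Z + 1 = K + n.+2%:Z by lia.
Qed.

Lemma bounded_right_shift v (K : nat) :
  bounded_right v <-> bounded_seq (fun n => v (K%:Z + n%:Z)).
Proof.
split=> [[B hB]|[B hB]]; first by exists B => n; exact: (hB (K + n)%N).
apply: (@bounded_of_eventually_bounded _ _ B K) => n Kn.
by have := hB (n - K)%N; have -> : K%:Z + (n - K)%N%:Z = n%:Z by lia.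
Qed.

Lemma int_shift_ind (P : int -> Prop) (m : int) :
  P m -> (forall k, m <= k -> P k -> P (k + 1)) ->
  (forall k, k <= m -> P k -> P (k - 1)) -> forall k, P k.
Proof.
move=> Pm Pu Pd k; case: (lerP m k) => mk.
  have -> : k = m + `|k - m|%N%:Z by lia.
  elim: `|k - m|%N => [|n IH]; first by rewrite addr0.
  have -> : m + n.+1%:Z = m + n%:Z + 1 by lia.
  by apply: Pu => //; lia.
have -> : k = m - `|m - k|%N%:Z by lia.
elim: `|m - k|%N => [|n IH]; first by rewrite subr0.
have -> : m - n.+1%:Z = m - n%:Z - 1 by lia.
by apply: Pd => //; lia.
Qed.

Lemma int_nonincreasing (u : int -> R) (j l : int) :
  (forall k, j <= k < l -> u (k + 1) <= u k) -> j <= l -> u l <= u j.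
Proof.
move=> h jl; have [n ln] : exists n : nat, l = j + n%:Z by exists `|l - j|%N; lia.
suff H i : (i <= n)%N -> u (j + i%:Z) <= u j by rewrite ln; exact: H.
elim: i => [|i IH] hi; first by rewrite addr0.
have -> : j + i.+1%:Z = j + i%:Z + 1 by lia.
by apply: le_trans (IH (ltnW hi)); apply: h; lia.
Qed.

Section Fixed.
Variables alpha beta : int -> C.
Hypothesis alpha_neq0 : forall k, alpha k != 0.

Lemma kernel_unique v (m : int) : kernel alpha beta v ->
  v m = 0 -> v (m + 1) = 0 -> forall k, v k = 0.
Proof.
move=> sv v0 v1 k; suff: v k = 0 /\ v (k + 1) = 0 by case.
apply: (@int_shift_ind (fun k => v k = 0 /\ v (k + 1) = 0) m) => // {}k _ [h0 h1].
  split=> //; have := sv (k + 1); rewrite /tridiag h1 addrK h0 !mulr0 !addr0.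
  by move/eqP; rewrite mulf_eq0 (negPf (alpha_neq0 _)) => /eqP.
rewrite subrK; split=> //; have := sv k; rewrite /tridiag h1 h0 !mulr0 !add0r.
by move/eqP; rewrite mulf_eq0 (negPf (alpha_neq0 _)) => /eqP.
Qed.

Lemma kernel_exists_at0 u0 u1 : exists v,
  [/\ kernel alpha beta v, v 0 = u0 & v 1 = u1].
Proof.
have [x [sx x0 x1]] := @half_sol_exists R (fun n => alpha n%:Z)
  (fun n => beta n%:Z) (fun n => alpha_neq0 n%:Z) u0 u1.
have [y [sy y0 y1]] := @half_sol_exists R (fun n => alpha (1 - n%:Z - 1))
  (fun n => beta (1 - n%:Z)) (fun n => alpha_neq0 _) u1 u0.
pose v (k : int) := match k with Posz n => x n | Negz n => y n.+2 end.
have vp n : v n%:Z = x n by [].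
have vn n : v (1 - n%:Z) = y n.
  case: n => [|[|n]]; first by rewrite subr0 y0 -x1.
    by rewrite subrr y1 -x0.
  by have -> : 1 - n.+2%:Z = Negz n by lia.
exists v; split; last 2 first.
- exact: x0.
- exact: x1.
move=> k; rewrite /tridiag; case: (ltrP 0 k) => k0.
  have [n ->] : exists n : nat, k = n.+1%:Z by exists `|k|.-1%N; lia.
  have -> : n.+1%:Z + 1 = n.+2%:Z by lia.
  have -> : n.+1%:Z - 1 = n%:Z by lia.
  by rewrite !vp; exact: sx.
have [n ->] : exists n : nat, k = 1 - n.+1%:Z by exists `|k|%N; lia.
have := sy n; rewrite -!vn.
have -> : 1 - n.+1%:Z + 1 = 1 - n%:Z by lia.
have -> : 1 - n.+1%:Z - 1 = 1 - n.+2%:Z by lia.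
have -> : 1 - n%:Z - 1 = 1 - n.+1%:Z by lia.
by move=> <-; ring.
Qed.
End Fixed.

Lemma kernel_exists alpha beta (m : int) u0 u1 : (forall k, alpha k != 0) ->
  exists v, [/\ kernel alpha beta v, v m = u0 & v (m + 1) = u1].
Proof.
move=> h; have [v [sv v0 v1]] := @kernel_exists_at0 (fun k => alpha (k + m))
  (fun k => beta (k + m)) (fun k => h (k + m)) u0 u1.
exists (fun k => v (k - m)); split.
- move=> k; have := sv (k - m); rewrite /tridiag !subrK.
  have -> : k - m - 1 + m = k - 1 by ring.
  have -> : k - m + 1 = k + 1 - m by ring.
  by have -> : k - m - 1 = k - 1 - m by ring.
- by rewrite subrr.
- by rewrite addrAC subrr add0r.
Qed.

Section RightEnd.
Variables alpha beta : int -> C.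
Hypothesis alpha_neq0 : forall k, alpha k != 0.
Hypothesis dom : dominant alpha beta.

Lemma dominant_half : exists (K : nat) (d : R), [/\ 0 < d,
  forall n, 2 * (normc (alpha (K%:Z + n.+1%:Z)) + normc (alpha (K%:Z + n%:Z))) <=
    normc (beta (K%:Z + n.+1%:Z)) &
  forall n, d <= normc (beta (K%:Z + n.+1%:Z))].
Proof.
case: dom => K [d [d0 h]]; exists K, d; split=> // n.
  have [] := h (K%:Z + n.+1%:Z) ltac:(lia).
  by have -> : K%:Z + n.+1%:Z - 1 = K%:Z + n%:Z by lia.
by have [] := h (K%:Z + n.+1%:Z) ltac:(lia).
Qed.

Lemma bounded_right_decay v : kernel alpha beta v -> bounded_right v ->
  exists K : nat, forall k, K%:Z <= k ->
  normc (v (k + 1)) <= 2^-1 * normc (v k) /\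
  normc (beta (k + 1)) * normc (v (k + 1)) <= 2 * (normc (alpha k) * normc (v k)).
Proof.
move=> sv bv; have [K [d [d0 h1 h2]]] := dominant_half.
exists K => k Kk.
have := bounded_half_sol_decay (fun n => alpha_neq0 (K%:Z + n%:Z)) h1 
  `|k - K%:Z|%N (kernel_half K sv) ((bounded_right_shift v K).1 bv).
have -> : K%:Z + `|k - K%:Z|.+1%N%:Z = k + 1 by lia.
by have -> : K%:Z + `|k - K%:Z|%N%:Z = k by lia.
Qed.

Lemma exists_bounded_right : exists v m,
  [/\ kernel alpha beta v, bounded_right v & v m = 1].
Proof.
have [K [d [d0 h1 h2]]] := dominant_half.
have [x [sx bx x0]] := @exists_bounded_half_sol R _ (fun n => beta (K%:Z + n%:Z))
  (fun n => alpha_neq0 (K%:Z + n%:Z)) h1 d d0 h2.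
have [v [sv v0 v1]] := @kernel_exists alpha beta K (x 0%N) (x 1%N) alpha_neq0.
exists v, K%:Z; split=> //; last by rewrite v0.
apply/(bounded_right_shift v K).
have vx n : v (K%:Z + n%:Z) = x n /\ v (K%:Z + n.+1%:Z) = x n.+1.
  elim: n => [|n [IH1 IH2]]; first by rewrite addr0.
  split=> //; have := kernel_half K sv n => /=; have := sx n.
  rewrite IH1 IH2 => <-; rewrite -!addrA => /addIr /mulfI; apply.
  exact: alpha_neq0.
by case: bx => B hB; exists B => n; rewrite (vx n).1.
Qed.

Lemma kernel_product_bounded x y : kernel alpha beta x -> bounded_right x ->
  kernel alpha beta y -> exists B, forall n : nat, normc (x n%:Z) * normc (y n%:Z) <= B.
Proof.
move=> sx bx sy; have [K [d [d0 h1 h2]]] := dominant_half.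
have [B hB] := half_sol_product_bounded (fun n => alpha_neq0 (K%:Z + n%:Z)) h1 d0 h2
  (kernel_half K sx) ((bounded_right_shift x K).1 bx) (kernel_half K sy).
apply: (@bounded_of_eventually_bounded _ _ B K) => n Kn.
by have := hB (n - K)%N; have -> : K%:Z + (n - K)%N%:Z = n%:Z by lia.
Qed.

Lemma unbounded_right_growth y : kernel alpha beta y -> ~ bounded_right y ->
  exists K : nat, forall k, K%:Z <= k -> 2 * normc (y k) <= normc (y (k + 1)).
Proof.
move=> sy nby; have [K [d [d0 h1 h2]]] := dominant_half.
have [by_|[m hm]] := half_sol_dichotomy (fun n => alpha_neq0 (K%:Z + n%:Z)) h1
  (kernel_half K sy); first by case: nby; apply/(bounded_right_shift y K).
exists (K + m)%N => k Kk; have := hm `|k - K%:Z|%N ltac:(lia).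
have -> : K%:Z + `|k - K%:Z|.+1%N%:Z = k + 1 by lia.
by have -> : K%:Z + `|k - K%:Z|%N%:Z = k by lia.
Qed.
End RightEnd.

Lemma bounded_both (v : int -> C) : bounded_right v -> bounded_left v ->
  exists B, 0 <= B /\ forall k, normc (v k) <= B.
Proof.
move=> [B hB] [B' hB']; exists (Num.max B B'); split.
  by rewrite le_max; apply/orP; left; apply: le_trans (hB 0%N); exact: normc_ge0.
move=> k; rewrite le_max; have [k0|k0] := lerP 0 k.
  by have := hB `|k|%N; rewrite gez0_abs // => ->.
have := hB' `|k|%N; have -> : - `|k|%N%:Z = k by lia.
by move=> ->; rewrite orbT.
Qed.

(** The equation bounds each value by half of the supremum, so that the
    supremum vanishes. *)
Lemma kernel_small_offdiag (alpha beta v : int -> C) :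
  (forall k, 2 * (normc (alpha k) + normc (alpha (k - 1))) <= normc (beta k)) ->
  (forall k, beta k != 0) -> kernel alpha beta v ->
  bounded_right v -> bounded_left v -> forall k, v k = 0.
Proof.
move=> hd b0 hv bR bL; have [B [B0 hB]] := bounded_both bR bL.
have h n k : normc (v k) <= B * 2^-1 ^+ n.
  elim: n k => [|n IH] k; first by rewrite expr0 mulr1.
  have bk : 0 < normc (beta k) by rewrite normc_gt0.
  rewrite -(ler_pM2l bk) -Normc.normcM.
  have -> : beta k * v k = - (alpha k * v (k + 1)) - alpha (k - 1) * v (k - 1).
    by apply/eqP; rewrite -subr_eq0 -(hv k) /tridiag; apply/eqP; ring.
  apply: le_trans (le_normcB _ _) _; rewrite normcN !Normc.normcM exprS.
  have e0 : 0 <= B * 2^-1 ^+ n by rewrite mulr_ge0 // exprn_ge0.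
  have h1 := ler_wpM2l (normc_ge0 (alpha k)) (IH (k + 1)).
  have h2 := ler_wpM2l (normc_ge0 (alpha (k - 1))) (IH (k - 1)).
  have := ler_wpM2r e0 (hd k); lra.
move=> k; apply/eqP; rewrite -normc_eq0 eq_le normc_ge0 andbT.
by apply: (@le0_of_half_pow _ _ B 0%N) => n _; exact: h.
Qed.

End Tridiagonal.

(** * Green's function of a tridiagonal operator *)

Section TwoSidedDecay.
Variable R : realType.
Local Notation normc := (@Normc.normc R).

Lemma exp2z_gt0 (k : int) : 0 < (2 : R) ^ k.
Proof. exact: exprz_gt0. Qed.

Lemma exp2zD1 (k : int) : (2 : R) ^ (k + 1) = 2 * 2 ^ k.
Proof. by rewrite expfzDr // expr1z mulrC. Qed.

Lemma half_pow_exp2z (k : int) : 0 <= k -> (2^-1 : R) ^+ `|k|%N = 2 ^ (- k).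
Proof. by case: k => // n _; rewrite exprVn exprnN. Qed.

(** The window where u and t are not monotone only costs a constant: as soon as
    j < K or - K < k, both u k and t j are bounded on the ranges that matter,
    and otherwise monotonicity moves the product to the diagonal. *)
Lemma product_bounded_off_diagonal (u t : int -> R) (B : R) (K : nat) :
  (forall k, 0 <= u k) -> (forall k, 0 <= t k) ->
  (forall k, K%:Z <= k -> u (k + 1) <= u k) ->
  (forall k, k < - K%:Z -> u (k + 1) <= u k) ->
  (forall k, K%:Z <= k -> t k <= t (k + 1)) ->
  (forall k, k < - K%:Z -> t k <= t (k + 1)) ->
  (forall k, u k * t k <= B) ->
  exists C, forall j k, j <= k -> u k * t j <= C.
Proof.
move=> u0 t0 uR uL tR tL ut.
have uincr j k : j <= k -> (K%:Z <= j) || (k <= - K%:Z) -> u k <= u j.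
  move=> jk h; apply: int_nonincreasing jk => l hl.
  by case/orP: h => h; [apply: uR; lia|apply: uL; lia].
have tincr j k : j <= k -> (K%:Z <= j) || (k <= - K%:Z) -> t j <= t k.
  move=> jk h; rewrite -lerN2; apply: (@int_nonincreasing R (fun k => - t k)) jk => l
    hl.
  by rewrite lerN2; case/orP: h => h; [apply: tR; lia|apply: tL; lia].
have [Bu hu] : exists Bu, forall n, u (- K%:Z + n%:Z) <= Bu.
  apply: (@bounded_of_eventually_bounded _ _ (u K%:Z) (K + K)) => n hn.
  by apply: uincr; lia.
have [Bt ht] : exists Bt, forall n, t (K%:Z - n%:Z) <= Bt.
  apply: (@bounded_of_eventually_bounded _ _ (t (- K%:Z)) (K + K)) => n hn.
  by apply: tincr; lia.
exists (Num.max B (Bu * Bt)) => j k jk; rewrite le_max.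
have [hj|hj] := lerP K%:Z j.
  by apply/orP; left; apply: le_trans (ut j); rewrite ler_wpM2r // uincr // hj.
have [hk|hk] := lerP k (- K%:Z).
  by apply/orP; left; apply: le_trans (ut k); rewrite ler_wpM2l // tincr // hk orbT.
apply/orP; right; apply: ler_pM => //.
  by have := hu (absz (k + K%:Z)); have -> : - K%:Z + (absz (k + K%:Z))%:Z = k by lia.
by have := ht `|K%:Z - j|%N; have -> : K%:Z - `|K%:Z - j|%N%:Z = j by lia.
Qed.

Lemma bounded_right_reflect (v : int -> R[i]) : bounded_left (v \o -%R) <->
  bounded_right v.
Proof. by split=> -[B hB]; exists B => n; have := hB n; rewrite /= opprK. Qed.

End TwoSidedDecay.

Section Green.
Variable R : realType.
Local Notation C := R[i].
Local Notation normc := (@Normc.normc R).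
Variables alpha beta : int -> C.
Hypothesis alpha_neq0 : forall k, alpha k != 0.

Lemma reflect_offdiag_neq0 k : reflect_offdiag alpha k != 0.
Proof. exact: alpha_neq0. Qed.

Lemma kernel_lin c v w : kernel alpha beta v -> kernel alpha beta w ->
  kernel alpha beta (fun k => v k + c * w k).
Proof.
move=> hv hw k; rewrite /tridiag.
transitivity (tridiag alpha beta v k + c * tridiag alpha beta w k).
  by rewrite /tridiag; ring.
by rewrite hv hw mulr0 addr0.
Qed.

Definition casoratian v w k := alpha k * (v k * w (k + 1) - v (k + 1) * w k).

Lemma casoratian_const v w k : kernel alpha beta v -> kernel alpha beta w ->
  casoratian v w k = casoratian v w 0.
Proof.
move=> hv hw.
have step m : casoratian v w m = casoratian v w (m - 1).
  rewrite /casoratian subrK; apply/eqP; rewrite -subr_eq0; apply/eqP.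
  transitivity (v m * tridiag alpha beta w m - w m * tridiag alpha beta v m).
    by rewrite /tridiag; ring.
  by rewrite hv hw !mulr0 subr0.
apply: (@int_shift_ind (fun m => casoratian v w m = casoratian v w 0) 0) => //.
  by move=> m _ <-; rewrite (step (m + 1)) addrK.
by move=> m _ <-; rewrite [RHS]step.
Qed.

Hypothesis domR : dominant alpha beta.
Hypothesis domL : dominant (reflect_offdiag alpha) (beta \o -%R).
Hypothesis no_bounded : forall v, kernel alpha beta v ->
  bounded_right v -> bounded_left v -> forall k, v k = 0.

(** Were the Casoratian zero, w would be a multiple of v, hence bounded at both
    ends. *)
Lemma casoratian_neq0 v w m p : kernel alpha beta v -> bounded_right v -> v m != 0 ->
  kernel alpha beta w -> bounded_left w -> w p != 0 -> casoratian v w 0 != 0.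
Proof.
move=> sv bv v0 sw bw w0; apply/negP => /eqP; rewrite /casoratian add0r => /eqP.
rewrite mulf_eq0 (negPf (alpha_neq0 _)) subr_eq0 /= => /eqP W0.
suff [c hc] : exists c, forall k, w k = c * v k.
  move: w0; rewrite (no_bounded sw _ bw) ?eqxx //.
  case: bv => B hB; exists (normc c * B) => n; rewrite hc Normc.normcM.
  by rewrite ler_wpM2l ?normc_ge0.
have [v00|v00] := eqVneq (v 0) 0; have [v10|v10] := eqVneq (v 1) 0.
- by move: v0; rewrite (kernel_unique alpha_neq0 sv v00) ?eqxx.
- exists (w 1 / v 1) => k; apply/eqP; rewrite -subr_eq0 -mulNr; apply/eqP.
  apply: (kernel_unique alpha_neq0 (kernel_lin (- (w 1 / v 1)) sw sv) (m := 0)).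
    move/eqP: W0; rewrite v00 mul0r eq_sym mulf_eq0 (negPf v10) /= => /eqP ->.
    by rewrite mulr0 addr0.
  by rewrite add0r mulNr divfK // subrr.
- exists (w 0 / v 0) => k; apply/eqP; rewrite -subr_eq0 -mulNr; apply/eqP.
  apply: (kernel_unique alpha_neq0 (kernel_lin (- (w 0 / v 0)) sw sv) (m := 0)).
    by rewrite mulNr divfK // subrr.
  move/eqP: W0; rewrite add0r v10 mul0r mulf_eq0 (negPf v00) /= => /eqP ->.
  by rewrite mulr0 addr0.
- exists (w 0 / v 0) => k; apply/eqP; rewrite -subr_eq0 -mulNr; apply/eqP.
  apply: (kernel_unique alpha_neq0 (kernel_lin (- (w 0 / v 0)) sw sv) (m := 0)).
    by rewrite mulNr divfK // subrr.
  rewrite add0r mulNr; have -> : w 0 / v 0 * v 1 = v 1 * w 0 / v 0 by ring.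
  by rewrite -W0 mulrAC divff // mul1r subrr.
Qed.

(** G k j is v k * w j or w k * v j according to the order of j and k, divided
    by the Casoratian, where v is bounded at +oo and w at -oo. Neither solution
    is bounded at its other end, so outside a window v halves and w
    doubles at each step to the right; this gives the decay away from the
    diagonal. *)
Lemma green_kernel : exists (G : int -> int -> C) (B : R), 0 <= B /\
  (forall j k, tridiag alpha beta (G^~ j) k = (k == j)%:R) /\
  (forall k j, normc (G k j) <= B * 2^-1 ^+ `|k - j|%N).
Proof.
have [v [m [sv bv vm]]] := exists_bounded_right alpha_neq0 domR.
have [w' [p [sw' bw' wp]]] := exists_bounded_right reflect_offdiag_neq0 domL.
pose w := w' \o -%R.
have sw : kernel alpha beta w.
  move=> k; rewrite -[k]opprK -tridiag_reflect -[RHS](sw' (- k)) /tridiag /w /=.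
  by rewrite !opprK.
have bw : bounded_left w by apply/bounded_right_reflect.
have v0 : v m != 0 by rewrite vm oner_neq0.
have w0 : w (- p) != 0 by rewrite /w /= opprK wp oner_neq0.
have W0 := casoratian_neq0 sv bv v0 sw bw w0.
set W := casoratian v w 0 in W0.
have nbv : ~ bounded_left v.
  by move=> h; move: v0; rewrite (no_bounded sv bv h) eqxx.
have nbw : ~ bounded_right w.
  by move=> h; move: w0; rewrite (no_bounded sw h bw) eqxx.
pose G k j := (if j <= k then v k * w j else w k * v j) / - W.
have [K1 h1] := bounded_right_decay alpha_neq0 domR sv bv.
have [K2 h2] := unbounded_right_growth alpha_neq0 domR sw nbw.
have [K3 h3] := bounded_right_decay reflect_offdiag_neq0 domL (kernel_reflect sw) bw.
have [K4 h4] := unbounded_right_growth reflect_offdiag_neq0 domL (kernel_reflect sv)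
  nbv.
pose K := (K1 + K2 + K3 + K4).+1.
have [B1 hB1] := kernel_product_bounded alpha_neq0 domR sv bv sw.
have [B2 hB2] := kernel_product_bounded reflect_offdiag_neq0 domL (kernel_reflect sw)
  bw (kernel_reflect sv).
have g0 := exp2z_gt0 R; have gD := exp2zD1 R.
have gN k : (2 : R) ^ k * 2 ^ (- k) = 1 by rewrite -expfzDr // subrr expr0z.
have gN1 k : (2 : R) ^ (- (k + 1)) = 2^-1 * 2 ^ (- k).
  have := gD (- (k + 1)); rewrite opprD subrK; lra.
have eNk (k : int) : - (- k - 1) = k + 1 by ring.
have [B hB] : exists B, forall j k, j <= k ->
    (normc (v k) * 2 ^ k) * (normc (w j) * 2 ^ (- j)) <= B.
  apply: (@product_bounded_off_diagonal R (fun k => normc (v k) * 2 ^ k)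
    (fun k => normc (w k) * 2 ^ (- k)) (Num.max B1 B2) K) => k.
  - by rewrite mulr_ge0 ?normc_ge0 // ltW.
  - by rewrite mulr_ge0 ?normc_ge0 // ltW.
  - move=> Kk; rewrite gD; have [h _] := h1 k ltac:(rewrite /K in Kk; lia).
    have := ler_wpM2r (ltW (g0 k)) h; lra.
  - move=> Kk; rewrite gD; have := h4 (- k - 1) ltac:(rewrite /K in Kk; lia).
    rewrite /= eNk subrK opprK => h.
    have := ler_wpM2r (ltW (g0 k)) h; lra.
  - move=> Kk; rewrite gN1; have := h2 k ltac:(rewrite /K in Kk; lia).
    by move=> /(ler_wpM2r (ltW (g0 (- k)))); lra.
  - move=> Kk; rewrite gN1; have [h _] := h3 (- k - 1) ltac:(rewrite /K in Kk; lia).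
    move: h; rewrite /= eNk subrK opprK => h.
    by have := ler_wpM2r (ltW (g0 (- k))) h; lra.
  rewrite mulrACA gN mulr1 le_max; have [k0|k0] := lerP 0 k.
    by have := hB1 `|k|%N; rewrite gez0_abs // => ->.
  have := hB2 `|k|%N; rewrite /=; have -> : - `|k|%N%:Z = k by lia.
  by rewrite mulrC => ->; rewrite orbT.
have B0 : 0 <= B.
  apply: le_trans (hB 0 0 (lexx _)).
  by rewrite !mulr_ge0 ?normc_ge0 // ltW.
have hvw j k : j <= k -> normc (v k) * normc (w j) <= B * 2^-1 ^+ `|k - j|%N.
  move=> jk; have := hB j k jk; rewrite half_pow_exp2z ?subr_ge0 //.
  rewrite mulrACA -expfzDr // => /(ler_wpM2r (ltW (g0 (- (k - j))))).
  by rewrite -[X in X <= _]mulrA gN mulr1.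
exists G, (B / normc W); split; first by rewrite mulr_ge0 // invr_ge0 normc_ge0.
split; last first.
  move=> k j; rewrite /G Normc.normcM Normc.normcV normcN mulrAC.
  rewrite ler_wpM2r ?invr_ge0 ?normc_ge0 //.
  case: (lerP j k) => jk; rewrite Normc.normcM; first exact: hvw.
  rewrite mulrC; have := hvw k j (ltW jk).
  by have -> : `|k - j|%N = `|j - k|%N by lia.
move=> j k; rewrite /tridiag /G.
have [jk|jk|->] := ltrgtP j k.
- have -> : (j <= k + 1) by lia.
  have -> : (j <= k - 1) by lia.
  transitivity (tridiag alpha beta v k * (w j / - W)); first by rewrite /tridiag; ring.
  by rewrite sv mul0r.
- have -> : (j <= k - 1) = false by lia.
  transitivity (tridiag alpha beta w k * (v j / - W)); last by rewrite sw mul0r.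
  rewrite /tridiag; case: (lerP j (k + 1)) => h; last by ring.
  have -> : j = k + 1 by lia.
  ring.
- have -> : (k <= k + 1) by lia.
  have -> : (k <= k - 1) = false by lia.
  have hw := sw k; have hW := casoratian_const k sv sw; rewrite -/W in hW.
  transitivity ((tridiag alpha beta w k * v k - casoratian v w k) / - W).
    by rewrite /tridiag /casoratian; ring.
  by rewrite hw hW mul0r sub0r divff // oppr_eq0.
Qed.
End Green.

(** * Square summable sequences through their finite windows *)

Section Window.

Definition window (n : nat) : seq int := [seq j%:Z - n%:Z | j <- index_iota 0 n.*2.+1].

Lemma mem_window n k : (k \in window n) = (`|k| <= n)%N.
Proof.
apply/mapP/idP => [[j]|kn]; first by rewrite mem_index_iota => h ->; lia.
by exists (absz (k + n%:Z)); [rewrite mem_index_iota; lia|lia].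
Qed.

Lemma window_uniq n : uniq (window n).
Proof. by rewrite map_inj_uniq ?iota_uniq // => i j; lia. Qed.

Lemma windowS n : window n.+1 = - n.+1%:Z :: rcons (window n) n.+1%:Z.
Proof.
rewrite /window doubleS /index_iota !subn0.
have -> : iota 0 n.*2.+3 = 0%N :: rcons (iota 1 n.*2.+1) n.*2.+2.
  have e : iota 1 n.*2.+2 = rcons (iota 1 n.*2.+1) n.*2.+2.
    by rewrite -[n.*2.+2 in LHS]addn1 iotaD cats1 add1n.
  by rewrite -e.
rewrite map_cons map_rcons sub0r; congr (_ :: rcons _ _); last by lia.
by rewrite -[1%N]addn0 iotaDl -map_comp; apply: eq_map => i /=; lia.
Qed.

Lemma big_windowS (T : nmodType) (F : int -> T) n :
  \sum_(k <- window n.+1) F k = F (- n.+1%:Z) + (\sum_(k <- window n) F k) + F n.+1%:Z.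
Proof. by rewrite windowS big_cons -cats1 big_cat big_seq1 addrA. Qed.

End Window.

Section SquareSummable.
Variable R : realType.
Local Notation C := R[i].
Local Notation normc := (@Normc.normc R).
Implicit Types v f : int -> C.

Lemma partial_sumZE (f : int -> C) n : partial_sumZ f n = \sum_(k <- window n) f k.
Proof. by rewrite /window big_map big_mkord. Qed.

Definition window_norm v n : R := \sum_(k <- window n) normc (v k) ^+ 2.

Lemma sqnormZ_le v (B : R) : (forall n, window_norm v n <= B) -> (sqnormZ v <= B%:E)%E.
Proof.
move=> h; apply: ge_ereal_sup => _ [X [finX _] <-].
pose n := (\max_(k <- finmap.enum_fset (fset_set X)) `|k : int|%N)%N.
apply: (@le_trans _ _ (\sum_(k \in [set` window n]) (normc (v k) ^+ 2)%:E)%E).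
  apply: lee_fsum_nneg_subset => //; first exact: finite_seq.
    move=> k; rewrite inE => Xk; rewrite inE /= mem_window /n.
    by apply: (@leq_bigmax_seq _ _ predT absz) => //; rewrite in_fset_set // inE.
  by move=> k _; rewrite lee_fin exprn_ge0 ?normc_ge0.
by rewrite -fsbig_seq ?window_uniq // sumEFin lee_fin; exact: h.
Qed.

Lemma window_norm_le_sqnormZ v n : ((window_norm v n)%:E <= sqnormZ v)%E.
Proof.
apply: esum_ge; exists [set` window n]; first by split; first exact: finite_seq.
by rewrite -fsbig_seq ?window_uniq // sumEFin.
Qed.

Lemma ell2_of_window_norm v (B : R) : (forall n, window_norm v n <= B) -> ell2 v.
Proof. by move=> /sqnormZ_le h; apply: le_lt_trans h _; rewrite ltry. Qed.

Lemma sqnormZ_ge0 v : (0 <= sqnormZ v)%E.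
Proof. by apply: esum_ge0 => k _; rewrite lee_fin exprn_ge0 ?normc_ge0. Qed.

Lemma ell2norm_sqr v : ell2 v -> ((ell2norm v ^+ 2)%:E = sqnormZ v)%E.
Proof.
move=> h; rewrite /ell2norm sqr_sqrtr ?fineK ?fine_ge0 ?sqnormZ_ge0 //.
by rewrite ge0_fin_numE // sqnormZ_ge0.
Qed.

Lemma ell2norm_ge0 v : 0 <= ell2norm v.
Proof. exact: sqrtr_ge0. Qed.

Lemma window_norm_le v n : ell2 v -> window_norm v n <= ell2norm v ^+ 2.
Proof. by move=> h; rewrite -lee_fin ell2norm_sqr //; exact: window_norm_le_sqnormZ.
  Qed.

Lemma ell2norm_le v (B : R) : 0 <= B -> (forall n, window_norm v n <= B ^+ 2) ->
  ell2norm v <= B.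
Proof.
move=> B0 h; rewrite -(@ler_pXn2r _ 2) ?nnegrE ?ell2norm_ge0 //.
by rewrite -lee_fin ell2norm_sqr ?sqnormZ_le //; apply: ell2_of_window_norm h.
Qed.

Lemma ell2norm_ge v k : ell2 v -> normc (v k) <= ell2norm v.
Proof.
move=> h; rewrite -(@ler_pXn2r _ 2) ?nnegrE ?ell2norm_ge0 ?normc_ge0 //.
apply: le_trans (window_norm_le `|k| h); rewrite /window_norm.
rewrite (bigD1_seq k) ?mem_window ?window_uniq //= lerDl.
by apply: sumr_ge0 => j _; rewrite exprn_ge0 // normc_ge0.
Qed.

Lemma ell2_lin (c : C) v f : ell2 v -> ell2 f -> ell2 (fun k => v k + c * f k).
Proof.
move=> hv hf; apply: (@ell2_of_window_norm _
  (2 * ell2norm v ^+ 2 + 2 * normc c ^+ 2 * ell2norm f ^+ 2)) => n.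
apply: (@le_trans _ _ (2 * window_norm v n + 2 * normc c ^+ 2 * window_norm f n)).
  rewrite /window_norm !mulr_sumr -big_split; apply: ler_sum => k _ /=.
  have h := le_normcD (v k) (c * f k).
  have h1 := normc_ge0 (v k + c * f k).
  have : normc (v k + c * f k) ^+ 2 <= (normc (v k) + normc (c * f k)) ^+ 2.
    by rewrite ler_pXn2r ?nnegrE // addr_ge0 ?normc_ge0.
  rewrite Normc.normcM; move: (normc (v k)) (normc c) (normc (f k)) => a b d.
  by have := sqr_ge0 (a - b * d); rewrite !expr2; lra.
apply: lerD; first by rewrite ler_wpM2l // window_norm_le.
by rewrite ler_wpM2l ?mulr_ge0 ?exprn_ge0 ?normc_ge0 // window_norm_le.
Qed.

Lemma ell2_bounded v : ell2 v -> bounded_right v /\ bounded_left v.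
Proof. by move=> h; split; exists (ell2norm v) => n; exact: ell2norm_ge. Qed.

Definition expw (k : int) : R := 2^-1 ^+ `|k|%N.

Lemma expw_gt0 k : 0 < expw k.
Proof. by rewrite exprn_gt0. Qed.

Lemma expw_le1 k : expw k <= 1.
Proof. by rewrite exprn_ile1 //; lra. Qed.

Lemma expwN k : expw (- k) = expw k.
Proof. by rewrite /expw abszN. Qed.

(** A discrete primitive of expw, with values between 0 and 3: sums of expw
    over intervals telescope. *)
Definition expw_primitive (k : int) : R := if 0 <= k then 3 - 2 * expw k else expw k.

Lemma expw_primitiveP k : expw_primitive (k + 1) - expw_primitive k = expw k.
Proof.
rewrite /expw_primitive; have [k0|k0] := lerP 0 k.
  have -> : 0 <= k + 1 by lia.
  by rewrite /expw (_ : `|(k + 1)%R|%N = `|k|.+1) ?exprS; [field|lia].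
have e : expw k = 2^-1 * expw (k + 1).
  by rewrite /expw -exprS; congr (_ ^+ _); lia.
have [h|h] := lerP 0 (k + 1); last by rewrite /= e; field.
have k1 : k + 1 = 0 by lia.
have w0 : expw 0 = 1 by rewrite /expw absz0 expr0.
by rewrite /= e k1 w0; field.
Qed.

Lemma sum_expw_le3 n (c : int) : \sum_(k <- window n) expw (k - c) <= 3.
Proof.
rewrite /window big_map.
have -> : \sum_(0 <= i < n.*2.+1) expw (i%:Z - n%:Z - c) =
    expw_primitive (n.*2.+1%:Z - n%:Z - c) - expw_primitive (0%:Z - n%:Z - c).
  rewrite -(telescope_sumr (fun i => expw_primitive (i%:Z - n%:Z - c))) //.
  apply: eq_bigr => i _; rewrite -expw_primitiveP; congr (expw_primitive _ - _); lia.
have h k : 0 <= expw_primitive k <= 3.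
  rewrite /expw_primitive; have := expw_gt0 k; have := expw_le1 k.
  by case: ifP => _; lra.
by have := h (n.*2.+1%:Z - n%:Z - c); have := h (0%:Z - n%:Z - c); lra.
Qed.

(** Cauchy-Schwarz for weights of total mass at most 3: expand the nonnegative
    sum of w i * (u i - S / 3) ^ 2, where S is the weighted sum. *)
Lemma sqr_weighted_sum (I : Type) (r : seq I) (w u : I -> R) :
  (forall i, 0 <= w i) -> \sum_(i <- r) w i <= 3 ->
  (\sum_(i <- r) w i * u i) ^+ 2 <= 3 * \sum_(i <- r) w i * u i ^+ 2.
Proof.
move=> w0 w3; set S := \sum_(i <- r) w i * u i; set Q := \sum_(i <- r) _ * _ ^+ 2.
have sqE m : \sum_(i <- r) w i * (u i - m) ^+ 2 = Q - 2 * m * S + m ^+ 2 * \sum_(i <-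
  r) w i.
  rewrite /Q /S !mulr_sumr -sumrB -big_split /=.
  by apply: eq_bigr => i _; ring.
have : 0 <= \sum_(i <- r) w i * (u i - S / 3) ^+ 2.
  by apply: sumr_ge0 => i _; rewrite mulr_ge0 ?sqr_ge0.
rewrite sqE.
have := ler_wpM2l (sqr_ge0 (S / 3)) w3; rewrite !expr2; lra.
Qed.

(** Schur's test for the exponential weight, on finite windows. *)
Lemma window_convolution_le (u : int -> R) n p :
  \sum_(k <- window n) (\sum_(j <- window p) expw (k - j) * u j) ^+ 2 <=
  9 * \sum_(j <- window p) u j ^+ 2.
Proof.
have w0 k : 0 <= expw k by rewrite ltW ?expw_gt0.
apply: (@le_trans _ _ (\sum_(k <- window n) 3 * \sum_(j <- window p) expw (k - j) * u
  j ^+ 2)).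
  apply: ler_sum => k _; apply: sqr_weighted_sum => //.
  under eq_bigr => j _ do rewrite -expwN opprB.
  exact: sum_expw_le3.
rewrite -mulr_sumr exchange_big /= (_ : 9 = 3 * 3 :> R); last by lra.
rewrite -mulrA ler_wpM2l // mulr_sumr; apply: ler_sum => j _.
by rewrite -mulr_suml ler_wpM2r ?sqr_ge0 // sum_expw_le3.
Qed.

Lemma expw_shift (k j : int) : expw (k - j) <= 2 ^+ `|k|%N * expw j.
Proof.
rewrite /expw -[2 ^+ _]invrK -exprVn ler_pdivlMl ?exprn_gt0 // -exprD.
by apply: ler_wiXn2l; [lra|lra|lia].
Qed.

(** The solution is the limit of the sums of G k j * f j over windows. These
    solve the equation exactly at every point inside the window, and the limit
    is geometrically fast at each point; the bound in norm comes from Schur's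
    test on the windows. *)
Lemma solve_of_kernel (alpha beta : int -> C) (G : int -> int -> C) (B : R) :
  0 <= B ->
  (forall j k, tridiag alpha beta (G^~ j) k = (k == j)%:R) ->
  (forall k j, normc (G k j) <= B * expw (k - j)) ->
  forall f, ell2 f -> exists v, [/\ forall k, tridiag alpha beta v k = f k,
    ell2 v & ell2norm v <= 5 * B * ell2norm f].
Proof.
move=> B0 hG bG f hf; set F := ell2norm f.
have F0 : 0 <= F := ell2norm_ge0 f.
have hfF k : normc (f k) <= F := ell2norm_ge k hf.
pose u N k := \sum_(j <- window N) G k j * f j.
have GF k j : normc (G k j * f j) <= B * F * (2 ^+ `|k|%N * expw j).
  rewrite Normc.normcM; apply: (@le_trans _ _ (B * expw (k - j) * F)).
    by apply: ler_pM => //; exact: normc_ge0.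
  by rewrite mulrAC ler_wpM2l ?mulr_ge0 // expw_shift.
have cu k N : normc (u N.+1 k - u N k) <= B * F * 2 ^+ `|k|%N * 2^-1 ^+ N.
  rewrite /u big_windowS.
  set x := G k (- _) * _; set y := \sum_(j <- _) _; set z := G k _ * _.
  have -> : x + y + z - y = x + z by ring.
  apply: le_trans (le_normcD _ _) _.
  apply: le_trans (lerD (GF _ _) (GF _ _)) _.
  rewrite expwN /expw absz_nat exprS; lra.
have /choice[v hv] k : exists l, forall N, normc (u N k - l) <= 4 * (B * F * 2 ^+
  `|k|%N) * 2^-1 ^+ N.
  exact: (complex_geometric_cvg (cu k)).
exists v.
(* 18 = 2 * 9: Schur's test gives 9, and v is the sum of u N and v - u N;
   5 is an upper bound for the square root of 18. *)
have vn n : window_norm v n <= (5 * B * F) ^+ 2.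
  suff : window_norm v n - 18 * (B * F) ^+ 2 <= 0.
    have := sqr_ge0 (B * F); rewrite !exprMn; lra.
  apply: (@le0_of_half_pow _ _ (2 * \sum_(k <- window n) (4 * (B * F * 2 ^+ `|k|%N))
    ^+ 2) 0%N) => N _.
  have h1 : \sum_(k <- window n) normc (u N k) ^+ 2 <= 9 * (B * F) ^+ 2.
    apply: (@le_trans _ _ (\sum_(k <- window n)
      (\sum_(j <- window N) expw (k - j) * (B * normc (f j))) ^+ 2)).
      apply: ler_sum => k _; rewrite ler_pXn2r ?nnegrE ?normc_ge0 //; last first.
        apply: sumr_ge0 => j _.
        by rewrite !mulr_ge0 ?normc_ge0 // ltW ?expw_gt0.
      apply: le_trans (normc_sum _ _ _) _; apply: ler_sum => j _.
      by rewrite Normc.normcM mulrA [_ * B]mulrC ler_wpM2r ?normc_ge0.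
    apply: le_trans (window_convolution_le _ _ _) _; rewrite ler_wpM2l //.
    under eq_bigr do rewrite exprMn.
    by rewrite -mulr_sumr exprMn ler_wpM2l ?sqr_ge0 // window_norm_le.
  apply: (@le_trans _ _ (2 * (\sum_(k <- window n) normc (u N k) ^+ 2)
     + 2 * (\sum_(k <- window n) (4 * (B * F * 2 ^+ `|k|%N)) ^+ 2) * 2^-1 ^+ N - 18 *
       (B * F) ^+ 2)); last by lra.
  rewrite lerD2r /window_norm -!mulrA !mulr_sumr mulr_suml mulr_sumr -big_split.
  apply: ler_sum => k _ /=.
  have h2 := le_normcB (u N k) (u N k - v k).
  rewrite opprB addrCA subrr addr0 in h2.
  have h3 := hv k N; set b := 4 * _ in h3 *.
  have b0 : 0 <= b by rewrite !mulr_ge0 ?exprn_ge0.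
  have h4 : (2^-1 : R) ^+ N <= 1 by rewrite exprn_ile1 //; lra.
  have h5 : 0 <= (2^-1 : R) ^+ N by rewrite exprn_ge0.
  move: h2 h3 (normc_ge0 (v k)) (normc_ge0 (u N k)) (normc_ge0 (u N k - v k)) h4 h5.
  move: (normc (v k)) (normc (u N k)) (normc (u N k - v k)) (2^-1 ^+ N)
    => V U D e h2 h3 V0 U0 D0 h4 h5.
  have t1 : V ^+ 2 <= (U + D) ^+ 2 by rewrite ler_pXn2r ?nnegrE // addr_ge0.
  have t2 : D ^+ 2 <= (b * e) ^+ 2 by rewrite ler_pXn2r ?nnegrE // mulr_ge0.
  have t3 : (b * e) ^+ 2 <= b ^+ 2 * e.
    rewrite exprMn ler_wpM2l ?sqr_ge0 // expr2; nra.
  have := sqr_ge0 (U - D); move: t1 t2 t3; rewrite !expr2; lra.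
split; last 2 first.
- exact: ell2_of_window_norm vn.
- by apply: ell2norm_le vn; rewrite !mulr_ge0.
move=> k; apply/eqP; rewrite -subr_eq0 -normc_eq0 eq_le normc_ge0 andbT.
have [c hc] : exists c : int -> R, forall k N, normc (u N k - v k) <= c k * 2^-1 ^+ N.
  by exists (fun k => 4 * (B * F * 2 ^+ `|k|%N)).
apply: (@le0_of_half_pow _ _ (normc (alpha k) * c (k + 1) + normc (beta k) * c k
  + normc (alpha (k - 1)) * c (k - 1)) `|k|%N) => N kN.
have uk : tridiag alpha beta (u N) k = f k.
  transitivity (\sum_(j <- window N) tridiag alpha beta (G^~ j) k * f j).
    rewrite /tridiag /u !mulr_sumr -!big_split /=.
    by apply: eq_bigr => j _; ring.
  rewrite (bigD1_seq k) ?mem_window ?window_uniq //= hG eqxx mul1r big1 ?addr0 // =>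
    j jk.
  by rewrite hG eq_sym (negPf jk) mul0r.
rewrite -uk.
have -> : tridiag alpha beta v k - tridiag alpha beta (u N) k =
   - (alpha k * (u N (k + 1) - v (k + 1)) + beta k * (u N k - v k) + alpha (k - 1) *
     (u N (k - 1) - v (k - 1))).
  by rewrite /tridiag; ring.
rewrite normcN; apply: le_trans (le_normcD _ _) _.
apply: le_trans (lerD (le_normcD _ _) (lexx _)) _.
rewrite !Normc.normcM !mulrDl -!mulrA.
by apply: lerD; [apply: lerD|]; rewrite ler_wpM2l ?normc_ge0 //; exact: hc.
Qed.

End SquareSummable.

(** * The adjoint of a Jacobi operator and its resolvent set *)

Section Adjoint.
Variable R : realType.
Local Notation C := R[i].
Local Notation normc := (@Normc.normc R).
Implicit Types (v w f g : int -> C) (a b : int -> R).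

(** The partial sums are eventually constant: for finitely supported sequences,
    sumZ is a finite sum and limits play no part. *)
Definition finite_sumZ f (S : C) := exists N, forall n, (N <= n)%N -> partial_sumZ f
  n = S.

Lemma sumZ_finite f S : finite_sumZ f S -> sumZ f = S.
Proof.
move=> [N hN]; rewrite /sumZ.
have lim_const (h : C -> R) : limn (fun n => h (partial_sumZ f n)) = h S.
  apply: cvg_lim => //; apply: cvg_near_cst.
  by exists N => // n /= Nn; rewrite hN.
by rewrite !lim_const; case: S {hN lim_const}.
Qed.

Lemma finite_sumZ_basis k g : finite_sumZ (fun j => basisZ R k j * g j) (g k).
Proof.
exists `|k|%N => n kn; rewrite partial_sumZE.
rewrite (bigD1_seq k) ?mem_window ?window_uniq //= big1 => [|j jk].
  by rewrite /basisZ eqxx mul1r addr0.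
by rewrite /basisZ (negPf jk) mul0r.
Qed.

Lemma finite_sumZ_lin u v g (x S S' : C) :
  finite_sumZ (fun j => u j * g j) S -> finite_sumZ (fun j => v j * g j) S' ->
  finite_sumZ (fun j => (u + x *: v) j * g j) (S + x * S').
Proof.
move=> [N hN] [N' hN']; exists (maxn N N') => n; rewrite geq_max => /andP[h h'].
rewrite -(hN n h) -(hN' n h') !partial_sumZE mulr_sumr -big_split /=.
by apply: eq_bigr => j _; rewrite mulrDl mulrA.
Qed.

Lemma finite_sumZ0 g : finite_sumZ (fun j => (0 : int -> C) j * g j) 0.
Proof. by exists 0%N => n _; rewrite partial_sumZE big1 // => j _; rewrite mul0r. Qed.

Lemma finite_sumZ_sum (s : seq int) (c : int -> C) (u : int -> int -> C) g (S : int
  -> C) :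
  (forall k, finite_sumZ (fun j => u k j * g j) (S k)) ->
  finite_sumZ (fun j => (\sum_(k <- s) c k *: u k) j * g j) (\sum_(k <- s) c k * S k).
Proof.
move=> h; elim: s => [|k s IH]; first by rewrite !big_nil; exact: finite_sumZ0.
by rewrite !big_cons addrC [X in finite_sumZ _ X]addrC; exact: finite_sumZ_lin.
Qed.

Lemma finite_sumZ_column a b k g : finite_sumZ (fun j => jacobi_column a b k j * g j)
  ((a k)%:C * g (k + 1) + (b k)%:C * g k + (a (k - 1))%:C * g (k - 1)).
Proof.
rewrite /jacobi_column -[X in X + _ + _]add0r -[X in finite_sumZ _ (X + _ + _)]add0r.
do 3 (apply: finite_sumZ_lin; last exact: finite_sumZ_basis).
exact: finite_sumZ0.
Qed.

Local Notation alphaC a := (fun k : int => (a k)%:C).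

Lemma conj_tridiag a b v k : (tridiag (alphaC a) (alphaC b) v k)^* =
  (a k)%:C * (v (k + 1))^* + (b k)%:C * (v k)^* + (a (k - 1))%:C * (v (k - 1))^*.
Proof. by rewrite /tridiag !rmorphD !rmorphM /= !oppr0. Qed.

(** Testing against the basis vector k gives the equation at k; conversely both
    inner products are finite sums, to be compared term by term. *)
Lemma adjoint_jacobiP a b v w : adjoint (jacobi a b) (v, w) <->
  [/\ ell2 v, ell2 w & forall k, tridiag (alphaC a) (alphaC b) v k = w k].
Proof.
split=> -[/= hv hw h]; split=> //.
  move=> k; apply: (can_inj (@conjcK R)); rewrite conj_tridiag.
  have := h (basisZ R k) (jacobi_column a b k); rewrite /inner.
  rewrite (sumZ_finite (finite_sumZ_basis k _)).
  rewrite (sumZ_finite (finite_sumZ_column a b k _)); apply.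
  by exists [:: k], (fun=> 1); rewrite /= !big_seq1 !scale1r.
move=> u x [s [c /= [-> ->]]]; rewrite /inner.
rewrite (sumZ_finite (finite_sumZ_sum _ _ (fun k => finite_sumZ_column a b k _))).
rewrite (sumZ_finite (finite_sumZ_sum _ _ (fun k => finite_sumZ_basis k _))).
by apply: eq_bigr => k _; rewrite -conj_tridiag h.
Qed.

Lemma adjoint_jacobi_shiftP a b z v f : ell2 f ->
  adjoint (jacobi a b) (v, z *: v + f) <->
  ell2 v /\ forall k, tridiag (alphaC a) (fun k => (b k)%:C - z) v k = f k.
Proof.
move=> hf; rewrite adjoint_jacobiP; split=> [[hv hw h]|[hv h]].
  split=> // k; apply: (@addrI _ (z * v k)).
  by rewrite -[RHS](h k) /tridiag; ring.
split=> //.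
  have -> : z *: v + f = (fun k => f k + z * v k).
    by apply/funext => k; rewrite addrC.
  exact: ell2_lin.
move=> k; have -> : (z *: v + f) k = z * v k + f k by [].
by rewrite -h /tridiag; ring.
Qed.

Lemma ell2_0 : ell2 (0 : int -> C).
Proof.
apply: (@ell2_of_window_norm _ _ 0) => n; rewrite /window_norm big1 // => k _.
by rewrite Normc.normc0 expr0n.
Qed.

(** With a dominant diagonal, boundedness improves to geometric decay at both
    ends. *)
Lemma ell2_of_bounded_kernel (alpha beta : int -> C) v : (forall k, alpha k != 0) ->
  dominant alpha beta -> dominant (reflect_offdiag alpha) (beta \o -%R) ->
  kernel alpha beta v -> bounded_right v -> bounded_left v -> ell2 v.
Proof.
move=> a0 dR dL sv bR bL.
have half (x : int -> C) (K : nat) :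
    (forall k, K%:Z <= k -> normc (x (k + 1)) <= 2^-1 * normc (x k)) ->
    exists B, forall n, normc (x n%:Z) * 2 ^+ n <= B.
  move=> h; apply: (@bounded_of_eventually_bounded _ _ (normc (x K%:Z) * 2 ^+ K) K)
    => n Kn.
  rewrite -(subnKC Kn); elim: (n - K)%N => [|m IH]; first by rewrite addn0.
  apply: le_trans IH; rewrite addnS exprS.
  have := h (K + m)%N ltac:(lia); have -> : (K + m)%N%:Z + 1 = (K + m).+1%:Z by lia.
  by have := @exprn_gt0 R (K + m)%N 2 ltac:(lra); move=> p0 /(ler_wpM2r (ltW p0)); lra.
have [K1 h1] := bounded_right_decay a0 dR sv bR.
have [K2 h2] := bounded_right_decay (reflect_offdiag_neq0 a0) dL (kernel_reflect sv) bL.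
have [B1 hB1] := half v K1 (fun k kK => (h1 k kK).1).
have [B2 hB2] := half _ K2 (fun k kK => (h2 k kK).1).
pose B := Num.max B1 B2.
have hB k : normc (v k) <= B * expw R k.
  rewrite /expw exprVn ler_pdivlMr ?exprn_gt0 // le_max.
  have [k0|k0] := lerP 0 k.
    by have := hB1 `|k|%N; rewrite gez0_abs // => ->.
  have := hB2 `|k|%N; rewrite /=; have -> : - `|k|%N%:Z = k by lia.
  by move=> ->; rewrite orbT.
have B0 : 0 <= B.
  have := hB 0; rewrite /expw absz0 expr0 mulr1; apply: le_trans; exact: normc_ge0.
apply: (@ell2_of_window_norm _ _ (B ^+ 2 * 3)) => n.
apply: (@le_trans _ _ (B ^+ 2 * \sum_(k <- window n) expw R (k - 0))).
  rewrite /window_norm mulr_sumr; apply: ler_sum => k _; rewrite subr0.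
  have e1 := expw_le1 R k; have e0 := expw_gt0 R k.
  apply: (@le_trans _ _ ((B * expw R k) ^+ 2)).
    by rewrite ler_pXn2r ?nnegrE ?normc_ge0 // mulr_ge0 // ltW.
  rewrite exprMn ler_wpM2l ?sqr_ge0 // expr2; nra.
by rewrite ler_wpM2l ?sqr_ge0 // sum_expw_le3.
Qed.

Lemma mem_spectrum_of_kernel a b z v m : ell2 v -> v m != 0 ->
  kernel (alphaC a) (fun k => (b k)%:C - z) v -> spectrum (adjoint (jacobi a b)) z.
Proof.
move=> hv vm sv [h _]; have [x [hx ux]] := h 0 ell2_0.
have e0 : x = 0.
  apply: ux; apply/adjoint_jacobi_shiftP; first exact: ell2_0.
  by split=> [|k]; [exact: ell2_0|rewrite /tridiag !mulr0 !addr0].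
have ev : x = v by apply: ux; apply/adjoint_jacobi_shiftP => //; exact: ell2_0.
by move: vm; rewrite -ev e0 eqxx.
Qed.

(** Injectivity on bounded sequences suffices: it yields the Green's function,
    hence surjectivity and the bound on the inverse. *)
Lemma mem_resolvent_set a b z : (forall k, a k != 0) ->
  dominant (alphaC a) (fun k => (b k)%:C - z) ->
  dominant (reflect_offdiag (alphaC a)) ((fun k => (b k)%:C - z) \o -%R) ->
  (forall v, kernel (alphaC a) (fun k => (b k)%:C - z) v ->
    bounded_right v -> bounded_left v -> forall k, v k = 0) ->
  resolvent_set (adjoint (jacobi a b)) z.
Proof.
move=> a0 dR dL nb.
have a0' k : (a k)%:C != 0 by rewrite -normc_eq0 normc_real normr_eq0.
have [G [B [B0 [hG bG]]]] := green_kernel a0' dR dL nb.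
have solve := solve_of_kernel B0 hG bG.
have uniq f v v' : ell2 f -> adjoint (jacobi a b) (v, z *: v + f) ->
    adjoint (jacobi a b) (v', z *: v' + f) -> v = v'.
  move=> hf /(adjoint_jacobi_shiftP _ _ _ _ hf)[hv h] /(adjoint_jacobi_shiftP _ _ _ _
    hf)[hv' h'].
  apply/funext => k; apply/eqP; rewrite -subr_eq0 -mulN1r; apply/eqP.
  have [bR bL] := ell2_bounded (ell2_lin (-1) hv hv').
  apply: (nb _ _ bR bL k) => j.
  transitivity (tridiag (alphaC a) (fun k => (b k)%:C - z) v j -
    tridiag (alphaC a) (fun k => (b k)%:C - z) v' j); first by rewrite /tridiag; ring.
  by rewrite h h' subrr.
have ex f : ell2 f -> exists2 v, adjoint (jacobi a b) (v, z *: v + f) &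
    ell2norm v <= 5 * B * ell2norm f.
  move=> hf; have [v [h hv nv]] := solve f hf.
  by exists v => //; apply/adjoint_jacobi_shiftP.
split=> [f hf|].
  by have [v hv _] := ex f hf; exists v; split=> // v' hv'; exact: (uniq f).
exists (5 * B) => v f hf hv; have [v' hv' nv'] := ex f hf.
by rewrite (uniq f v v').
Qed.

End Adjoint.

(** * The coefficients, and the ladder between z and qz *)

Section Coefficients.
Variable R : realType.
Local Notation C := R[i].
Local Notation normc := (@Normc.normc R).
Variables q t : R.
Hypotheses (q_gt0 : 0 < q) (q_lt1 : q < 1) (t_gt0 : 0 < t).

Local Notation s := (Num.sqrt q).
Local Notation A := (coef_a q t).

Lemma s_gt0 : 0 < s. Proof. by rewrite sqrtr_gt0. Qed.

Lemma s_lt1 : s < 1.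
Proof. by rewrite -[ltRHS]sqrtr1 ltr_sqrt. Qed.

Lemma sqr_s : s ^+ 2 = q. Proof. by rewrite sqr_sqrtr // ltW. Qed.

Lemma s_neq0 : s != 0. Proof. by rewrite gt_eqF // s_gt0. Qed.

Lemma coef_a_gt0 k : 0 < A k.
Proof. by rewrite invr_gt0 sqrtr_gt0 mulr_gt0 // exprz_gt0. Qed.

Lemma coef_aE k : A k = (Num.sqrt t * s ^ (k + 1))^-1.
Proof.
rewrite /coef_a; congr (_^-1); rewrite sqrtrM ?(ltW t_gt0) //; congr (_ * _).
have h : 0 <= s ^ (k + 1) by rewrite exprz_ge0 // ltW // s_gt0.
rewrite -[RHS](ger0_norm h) -sqrtr_sqr; congr Num.sqrt.
by rewrite [RHS]exprnP exprz_exp mulrC -exprz_exp -exprnP sqr_s.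
Qed.

Lemma coef_a_next k : A k = s * A (k + 1).
Proof.
rewrite !coef_aE [in RHS]expfzDr ?s_neq0 // expr1z.
have h : s ^ (k + 1) != 0 by rewrite expfz_neq0 // s_neq0.
have h2 : Num.sqrt t != 0 by rewrite gt_eqF // sqrtr_gt0.
by field; rewrite h h2 s_neq0.
Qed.

(** This relation between the diagonal and the off-diagonal entries factors
    1 - J into a product of two bidiagonal operators, and is the source of the
    maps lower and raise. *)
Lemma coef_bE k : coef_b q t k = - A (k - 1) ^+ 2.
Proof.
rewrite /coef_b /coef_a subrK exprVn sqr_sqrtr //.
by rewrite mulr_ge0 ?ltW // exprz_gt0.
Qed.

Lemma coef_a_shift (k : int) n : A (k + n%:Z) * s ^+ n = A k.
Proof.
elim: n => [|n IH]; first by rewrite addr0 expr0 mulr1.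
rewrite -{}IH [A (k + n%:Z)]coef_a_next exprS.
have -> : k + n.+1%:Z = k + n%:Z + 1 by lia.
by ring.
Qed.

Lemma coef_a_le (j k : int) : j <= k -> A j <= A k.
Proof.
move=> jk; have -> : k = j + `|k - j|%N%:Z by lia.
rewrite -(coef_a_shift j `|k - j|%N); apply: ler_piMr; first by rewrite ltW //
  coef_a_gt0.
by rewrite exprn_ile1 // ltW // (s_gt0, s_lt1).
Qed.

Lemma coef_a_large (M : R) : exists K : nat, forall k, K%:Z <= k -> M <= A k.
Proof.
have s01 : 0 <= s < 1 by rewrite ltW ?s_gt0 // s_lt1.
have M1 : 0 < `|M| + 1 by rewrite ltr_wpDl.
have [n hn] := pow_small s01 (divr_gt0 (coef_a_gt0 0) M1).
exists n => k nk; apply: le_trans (coef_a_le nk).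
move: hn; rewrite ltr_pdivlMr // -(coef_a_shift 0 n) add0r.
have sn : 0 < s ^+ n by rewrite exprn_gt0 // s_gt0.
rewrite mulrC ltr_pM2r // => h; have := ler_norm M; lra.
Qed.

Lemma coef_a_small (e : R) : 0 < e -> exists K : nat, forall k, k <= - K%:Z -> A k <= e.
Proof.
move=> e0; have s01 : 0 <= s < 1 by rewrite ltW ?s_gt0 // s_lt1.
have [n hn] := pow_small s01 (divr_gt0 e0 (coef_a_gt0 0)).
exists n => k nk; apply: le_trans (coef_a_le nk) _.
rewrite -(coef_a_shift _ n) addNr mulrC.
by move: hn; rewrite ltr_pdivlMr ?coef_a_gt0 // => /ltW.
Qed.

Definition offdiag (k : int) : C := (A k)%:C.
Definition diag (z : C) (k : int) : C := (coef_b q t k)%:C - z.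
Local Notation sg := (s%:C).
Local Notation a := offdiag.

Lemma sg_neq0 : sg != 0 :> C.
Proof. by rewrite -normc_eq0 normc_real normr_eq0 s_neq0. Qed.

Lemma offdiag_neq0 k : a k != 0.
Proof. by rewrite -normc_eq0 normc_real normr_eq0 gt_eqF // coef_a_gt0. Qed.

Lemma normc_offdiag k : normc (a k) = A k.
Proof. by rewrite normc_real ger0_norm // ltW // coef_a_gt0. Qed.

Lemma offdiag_next k : a (k + 1) = a k / sg.
Proof. by rewrite /a [A k]coef_a_next rmorphM mulrAC divff ?mul1r // sg_neq0. Qed.

Lemma offdiag_prev k : a (k - 1) = sg * a k.
Proof. by rewrite -{2}[k](subrK 1) offdiag_next mulrCA divff ?mulr1 // sg_neq0. Qed.

Lemma diagE z k : diag z k = - (a (k - 1)) ^+ 2 - z.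
Proof. by rewrite /diag coef_bE rmorphN rmorphXn. Qed.

Lemma normc_diag_ge z k : A (k - 1) ^+ 2 - normc z <= normc (diag z k) /\
  normc z - A (k - 1) ^+ 2 <= normc (diag z k).
Proof.
have nA : normc ((a (k - 1)) ^+ 2) = A (k - 1) ^+ 2.
  by rewrite expr2 Normc.normcM normc_offdiag.
have -> : normc (diag z k) = normc (a (k - 1) ^+ 2 + z).
  by rewrite -[RHS]normcN diagE opprD.
rewrite -nA; split.
  by have := ler_normc_dist (a (k - 1) ^+ 2) (- z); rewrite normcN opprK.
rewrite [a _ ^+ 2 + z]addrC.
by have := ler_normc_dist z (- a (k - 1) ^+ 2); rewrite normcN opprK.
Qed.

Lemma dominant_right z : dominant a (diag z).
Proof.
pose c := 2 * (s^-1 + 1); have si : 0 < s^-1 by rewrite invr_gt0 s_gt0.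
have z0 := normc_ge0 z.
have [K hK] := coef_a_large (c + normc z + 1).
exists K.+1, 1; split=> // k Kk; rewrite !normc_offdiag.
have Ak : A k = s^-1 * A (k - 1).
  by rewrite [in RHS]coef_a_next subrK mulrA mulVf ?mul1r // s_neq0.
have [h _] := normc_diag_ge z k.
have := hK (k - 1) ltac:(lia) => hA; rewrite Ak.
move: (A (k - 1)) hA h; rewrite /c => x hA h; have x1 : 1 <= x by lra.
have h2 : (2 * (s^-1 + 1) + normc z + 1) * x <= x * x by rewrite ler_wpM2r //; lra.
have h3 : 0 <= normc z * (x - 1) by rewrite mulr_ge0 // subr_ge0.
have h4 : 0 <= s^-1 * x by rewrite mulr_ge0 //; lra.
rewrite expr2 in h; split; lra.
Qed.

Lemma dominant_left z : z != 0 -> dominant (reflect_offdiag a) (diag z \o -%R).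
Proof.
rewrite -normc_gt0 => z0.
pose c := 2 * (s^-1 + 1) + 1; have si : 0 < s^-1 by rewrite invr_gt0 s_gt0.
have c0 : 0 < 2 * c by rewrite /c; lra.
have e0 : 0 < Num.min 1 (normc z / (2 * c)) by rewrite lt_min ltr01 divr_gt0.
have [K hK] := coef_a_small e0.
exists K, (normc z / 2); split; first by rewrite divr_gt0.
move=> k Kk; rewrite /reflect_offdiag !normc_offdiag /=.
have -> : - (k - 1) - 1 = - k by ring.
have Ak : A (- k) = s^-1 * A (- k - 1).
  by rewrite [in RHS]coef_a_next subrK mulrA mulVf ?mul1r // s_neq0.
have [_ h] := normc_diag_ge z (- k).
have := hK (- k - 1) ltac:(lia); rewrite le_min ler_pdivlMr // => /andP[x1 xz].
have := coef_a_gt0 (- k - 1); rewrite Ak.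
move: (A (- k - 1)) x1 xz h => x x1 xz h x0.
have h2 : x * x <= x by rewrite ler_piMl // ltW.
have h4 : 0 <= s^-1 * x by rewrite mulr_ge0 // ltW.
rewrite expr2 in h; rewrite /c in xz; split; lra.
Qed.

(** For nonzero z the bounded eigensequences are the square summable ones, and
    suprema are easier to control than sums. *)
Definition bounded_eigenvalue z := exists v m, [/\ kernel a (diag z) v,
  bounded_right v, bounded_left v & v m != 0].

Lemma q_sg2 : q%:C = sg ^+ 2 :> C.
Proof. by rewrite -rmorphXn sqr_s. Qed.

(** Lowering and raising form a Darboux transformation: exchanging the two
    bidiagonal factors of 1 - J replaces J by q J, up to a shift of the indices.
    Here lower sends the eigensequences for q z to those for z, and
    raise does the converse. *)
Definition lower (z : C) (v : int -> C) k := q%:C * z * v (k - 1) / a (k - 1) - v k.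

(** The definition of lower controls it near +oo, where 1 / a is bounded; the
    present form controls it near -oo, where a is bounded. *)
Lemma lowerE z v k : kernel a (diag (q%:C * z)) v ->
  lower z v k = sg * v (k - 2) - sg * a (k - 2) * v (k - 1).
Proof.
move=> /(_ (k - 1)); rewrite /tridiag subrK diagE /lower.
have -> : k - 1 - 1 = k - 2 by ring.
have e : a (k - 2) = sg * a (k - 1) by rewrite -offdiag_prev; congr a; ring.
rewrite e; move: (offdiag_neq0 (k - 1)); move: (a (k - 1)) => x x0 h.
apply/eqP; rewrite -subr_eq0; apply/eqP.
rewrite -[RHS](mulr0 (- x^-1)) -{}h; field; exact: x0.
Qed.

Lemma lower_kernel z v : kernel a (diag (q%:C * z)) v -> kernel a (diag z) (lower z v).
Proof.
move=> h k; have h0 := h k; have h1 := h (k - 1).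
move: h0 h1; rewrite /tridiag /lower !diagE !subrK !addrK q_sg2.
have -> : a (k - 1 - 1) = sg * a (k - 1) by rewrite offdiag_prev.
have -> : a k = a (k - 1) / sg by rewrite -offdiag_next subrK.
move: (offdiag_neq0 (k - 1)) sg_neq0; move: (a (k - 1)) => y y0 s0 h0 h1.
transitivity (z / y * (y * v k + (- (sg * y) ^+ 2 - sg ^+ 2 * z) * v (k - 1) +
    sg * y * v (k - 1 - 1)) -
  (y / sg * v (k + 1) + (- y ^+ 2 - sg ^+ 2 * z) * v k + y * v (k - 1))).
  by field; rewrite y0 s0.
by rewrite h0 h1 mulr0 subr0.
Qed.

(** The two expressions of lower show that it annihilates v only if
    (q z - 1) v = 0. *)
Lemma bounded_eigenvalue_lower z : q%:C * z != 1 ->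
  bounded_eigenvalue (q%:C * z) -> bounded_eigenvalue z.
Proof.
move=> z1 [v [m [hv bR bL vm]]]; have [B [B0 hB]] := bounded_both bR bL.
have [m' hm'] : exists m', lower z v m' != 0.
  apply/not_existsP => h; have h0 k : lower z v k = 0.
    by apply/eqP; move: (h k) => /negP; rewrite negbK.
  have e1 := h0 (m + 1); have e2 := h0 (m + 2).
  rewrite /lower addrK in e1; rewrite (lowerE _ hv) in e2.
  have k1 : m + 2 - 2 = m by ring.
  have k2 : m + 2 - 1 = m + 1 by ring.
  rewrite k1 k2 in e2.
  have : (q%:C * z - 1) * v m = 0.
    transitivity (a m * (q%:C * z * v m / a m - v (m + 1)) -
      sg^-1 * (sg * v m - sg * a m * v (m + 1))).
      by field; rewrite sg_neq0 offdiag_neq0.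
    by rewrite e1 e2 !mulr0 subr0.
  by move/eqP; rewrite mulf_eq0 (negPf vm) orbF subr_eq0 (negPf z1).
exists (lower z v), m'; split=> //; first exact: lower_kernel.
  exists (normc (q%:C * z) * B / A (-1) + B) => n; rewrite /lower.
  apply: le_trans (le_normcB _ _) _; apply: lerD => //.
  rewrite Normc.normcM Normc.normcV normc_offdiag Normc.normcM.
  apply: ler_pM; rewrite ?invr_ge0 ?mulr_ge0 ?normc_ge0 ?(ltW (coef_a_gt0 _)) //.
    by rewrite ler_wpM2l ?normc_ge0.
  by rewrite lef_pV2 ?posrE ?coef_a_gt0 // coef_a_le //; lia.
exists (s * B + s * A 0 * B) => n; rewrite (lowerE _ hv).
have s0 := ltW s_gt0.
apply: le_trans (le_normcB _ _) _; rewrite !Normc.normcM normc_offdiag normc_real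
  ger0_norm //.
apply: lerD; first by rewrite ler_wpM2l.
apply: ler_pM; rewrite ?mulr_ge0 ?normc_ge0 ?(ltW (coef_a_gt0 _)) //.
by rewrite ler_wpM2l // coef_a_le //; lia.
Qed.

(** A bounded solution decays faster than any geometric sequence at +oo, since
    A k is unbounded. This absorbs the unbounded coefficient of raise. *)
Lemma bounded_right_fast z v : kernel a (diag z) v -> bounded_right v ->
  exists K : nat, forall k, K%:Z <= k -> A k * normc (v (k + 1)) <= 4 * normc (v k).
Proof.
move=> hv bR; have [K1 h1] := bounded_right_decay offdiag_neq0 (dominant_right z) hv bR.
have [K2 h2] := coef_a_large (2 * normc z + 1).
exists (K1 + K2)%N => k kK; have [_ h] := h1 k ltac:(lia).
have hA := h2 k ltac:(lia); have [hd _] := normc_diag_ge z (k + 1).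
rewrite addrK in hd; rewrite normc_offdiag in h.
have A0 := coef_a_gt0 k; have z0 := normc_ge0 z.
move: (normc_ge0 (v k)) (normc_ge0 (v (k + 1))) hd h A0 hA.
move: (A k) (normc (v k)) (normc (v (k + 1))) (normc (diag z (k + 1)))
  => x u w d u0 w0 hd h x0 hx.
rewrite expr2 in hd.
have h3 : x * x <= 2 * d.
  have : (2 * normc z + 1) * x <= x * x by rewrite ler_wpM2r // ltW.
  have : 0 <= normc z * (x - 1) by rewrite mulr_ge0 // subr_ge0; lra.
  lra.
have h4 : x * (x * w) <= x * (4 * u) by have := ler_wpM2r w0 h3; lra.
by move: h4; rewrite ler_pM2l.
Qed.

Definition raise (v : int -> C) k := a k * v (k + 1) - sg^-1 * v (k + 2).

Lemma raise_kernel z v : kernel a (diag z) v -> kernel a (diag (q%:C * z)) (raise v).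
Proof.
move=> h k; have h0 := h (k + 1); have h1 := h (k + 2).
move: h0 h1; rewrite /tridiag /raise !diagE !subrK !addrK q_sg2.
have -> : k + 2 - 1 = k + 1 by ring.
have -> : k + 1 + 1 = k + 2 by ring.
have -> : k - 1 + 2 = k + 1 by ring.
have -> : k + 2 + 1 = k + 3 by ring.
have -> : k + 1 + 2 = k + 3 by ring.
have -> : a (k + 2) = a k / sg / sg by rewrite -!offdiag_next; congr a; ring.
rewrite !offdiag_next offdiag_prev.
move: (offdiag_neq0 k) sg_neq0; move: (a k) => y y0 s0 h0 h1.
transitivity (sg ^+ 2 * y * (y / sg * v (k + 2) + (- y ^+ 2 - z) * v (k + 1) + y * v
  k) -
  sg * (y / sg / sg * v (k + 3) + (- (y / sg) ^+ 2 - z) * v (k + 2) + y / sg * v (k +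
    1))).
  by field; rewrite s0.
by rewrite h0 h1 !mulr0 subr0.
Qed.

Lemma bounded_eigenvalue_raise z : q%:C * z != 1 ->
  bounded_eigenvalue z -> bounded_eigenvalue (q%:C * z).
Proof.
move=> z1 [v [m [hv bR bL vm]]]; have [B [B0 hB]] := bounded_both bR bL.
have [m' hm'] : exists m', raise v m' != 0.
  apply/not_existsP => h; have h0 k : raise v k = 0.
    by apply/eqP; move: (h k) => /negP; rewrite negbK.
  have e1 := h0 (m - 1); have e2 := h0 (m - 2); have e0 := hv m.
  move: e0 e1 e2; rewrite /raise /tridiag subrK diagE.
  have -> : m - 1 + 2 = m + 1 by ring.
  have -> : m - 2 + 2 = m by ring.
  have -> : m - 2 + 1 = m - 1 by ring.
  have -> : a (m - 2) = sg * (sg * a m) by rewrite -!offdiag_prev; congr a; ring.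
  rewrite offdiag_prev => e0 e1 e2.
  have : (1 - q%:C * z) * v m = 0.
    rewrite q_sg2.
    transitivity (sg ^+ 2 * (a m * v (m + 1) + (- (sg * a m) ^+ 2 - z) * v m +
      sg * a m * v (m - 1)) + sg ^+ 3 * a m * (sg * a m * v m - sg^-1 * v (m + 1))
      - sg * (sg * (sg * a m) * v (m - 1) - sg^-1 * v m)).
      by field; rewrite sg_neq0.
    by rewrite e0 e1 e2 !mulr0 addr0 subr0.
  by move/eqP; rewrite mulf_eq0 (negPf vm) orbF subr_eq0 eq_sym (negPf z1).
have si : 0 <= s^-1 by rewrite invr_ge0 ltW // s_gt0.
have nr k : normc (raise v k) <= A k * normc (v (k + 1)) + s^-1 * B.
  apply: le_trans (le_normcB _ _) _; rewrite !Normc.normcM normc_offdiag.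
  rewrite Normc.normcV normc_real ger0_norm; last by rewrite ltW // s_gt0.
  by apply: lerD => //; rewrite ler_wpM2l.
exists (raise v), m'; split=> //; first exact: raise_kernel.
  have [K hK] := bounded_right_fast hv bR.
  apply: (@bounded_of_eventually_bounded _ _ (4 * B + s^-1 * B) K) => n Kn.
  apply: le_trans (nr _) _; apply: lerD => //.
  apply: le_trans (hK n%:Z ltac:(lia)) _; by rewrite ler_wpM2l.
exists (A 0 * B + s^-1 * B) => n; apply: le_trans (nr _) _; apply: lerD => //.
apply: ler_pM; rewrite ?normc_ge0 ?(ltW (coef_a_gt0 _)) //.
by rewrite coef_a_le //; lia.
Qed.

Lemma diag_dominates z : z != 0 -> (forall k, diag z k != 0) ->
  exists c, 0 < c /\ forall k, c * (A k + A (k - 1)) <= normc (diag z k).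
Proof.
move=> z0 d0; have dp k : 0 < normc (diag z k) by rewrite normc_gt0.
pose rho k := (A k + A (k - 1)) / normc (diag z k).
have rho_le k : 2 * (A k + A (k - 1)) <= normc (diag z k) -> rho k <= 2^-1.
  by rewrite /rho ler_pdivrMr //; lra.
have [K1 [d1 [_ h1]]] := dominant_right z.
have [K2 [d2 [_ h2]]] := dominant_left z0.
have [B1 hB1] : exists B, forall n, rho n%:Z <= B.
  apply: (@bounded_of_eventually_bounded _ _ 2^-1 K1) => n hn.
  by apply: rho_le; have [] := h1 n%:Z ltac:(lia); rewrite !normc_offdiag.
have [B2 hB2] : exists B, forall n, rho (- n%:Z) <= B.
  apply: (@bounded_of_eventually_bounded _ _ 2^-1 K2) => n hn.
  apply: rho_le; have [] := h2 n%:Z ltac:(lia); rewrite /reflect_offdiag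
    !normc_offdiag /=.
  by have -> : - (n%:Z - 1) - 1 = - n%:Z by [ring]; rewrite addrC.
pose B := `|B1| + `|B2| + 1.
have Bp : 0 < B by rewrite ltr_wpDl // addr_ge0.
exists B^-1; split; first by rewrite invr_gt0.
move=> k; rewrite mulrC ler_pdivrMr // mulrC -ler_pdivrMr // -/(rho k).
have := ler_norm B1; have := ler_norm B2.
have := normr_ge0 B1; have := normr_ge0 B2.
have [k0|k0] := lerP 0 k.
  by have := hB1 `|k|%N; rewrite gez0_abs // /B; lra.
have := hB2 `|k|%N; have -> : - `|k|%N%:Z = k by lia.
rewrite /B; lra.
Qed.

Lemma q_neq0 : q%:C != 0 :> C.
Proof. by rewrite -normc_eq0 normc_real normr_eq0 gt_eqF. Qed.

Lemma offdiag_shift (k : int) n : a (k + n%:Z) * sg ^+ n = a k.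
Proof. by rewrite -rmorphXn -rmorphM coef_a_shift. Qed.

Lemma bounded_eigenvalue_div z n : (forall j : nat, z != (q ^+ j)%:C) ->
  bounded_eigenvalue z -> bounded_eigenvalue (z / q%:C ^+ n).
Proof.
move=> hz h; elim: n => [|n IH]; first by rewrite expr0 divr1.
have qn : q%:C ^+ n != 0 :> C by rewrite expf_neq0 // q_neq0.
have e : q%:C * (z / q%:C ^+ n.+1) = z / q%:C ^+ n.
  by rewrite exprS; field; rewrite q_neq0 qn.
apply: bounded_eigenvalue_lower; rewrite e //.
apply: contra (hz n) => /eqP h1; rewrite rmorphXn /=.
by rewrite -[z](divfK qn) h1 mul1r.
Qed.

(** Lowering n times gives a bounded eigensequence for z / q ^ n. After a shift
    of the index by n, it solves the equation for z with all the off-diagonal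
    entries multiplied by s ^ n, where s is the square root of q; for large n
    these are too small compared with the diagonal. *)
Lemma not_bounded_eigenvalue z : z != 0 -> (forall k, diag z k != 0) ->
  (forall j : nat, z != (q ^+ j)%:C) -> ~ bounded_eigenvalue z.
Proof.
move=> z0 d0 hz /bounded_eigenvalue_div - /(_ _ hz) h.
have [c [c0 hc]] := diag_dominates z0 d0.
have s01 : 0 <= s < 1 by rewrite ltW ?s_gt0 // s_lt1.
have c2 : 0 < c / 2 by rewrite divr_gt0.
have [n hn] := pow_small s01 c2.
have [v [m [hv bR bL vm]]] := h n.
have [B [_ hB]] := bounded_both bR bL.
pose u k := v (k + n%:Z).
have sn : sg ^+ n != 0 :> C by rewrite expf_neq0 // sg_neq0.
have s0 : 0 <= s ^+ n by rewrite exprn_ge0 // ltW // s_gt0.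
suff : u (m - n%:Z) = 0 by rewrite /u subrK => e; rewrite e eqxx in vm.
apply: (@kernel_small_offdiag R (fun k => sg ^+ n * a k) (diag z)) => //.
- move=> k; rewrite !Normc.normcM !normc_offdiag -rmorphXn normc_real ger0_norm //.
  apply: le_trans (hc k); have := coef_a_gt0 k; have := coef_a_gt0 (k - 1) => h1 h2.
  have h3 : s ^+ n * (A k + A (k - 1)) <= c / 2 * (A k + A (k - 1)).
    by rewrite ler_wpM2r ?ltW // addr_gt0.
  lra.
- move=> k; have := hv (k + n%:Z); rewrite /tridiag /u.
  have -> : k + n%:Z + 1 = k + 1 + n%:Z by ring.
  have -> : k + n%:Z - 1 = k - 1 + n%:Z by ring.
  have -> : a (k + n%:Z) = a k / sg ^+ n by rewrite -(offdiag_shift k n) mulfK.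
  have -> : a (k - 1 + n%:Z) = a (k - 1) / sg ^+ n by rewrite -(offdiag_shift (k - 1)
    n) mulfK.
  rewrite !diagE; have -> : k + n%:Z - 1 = k - 1 + n%:Z by ring.
  rewrite -(offdiag_shift (k - 1) n) q_sg2 -exprM mulnC exprM.
  move: (v (k + 1 + n%:Z)) (v (k + n%:Z)) (v (k - 1 + n%:Z)) (a k) (a (k - 1 + n%:Z))
    sn; move: (sg ^+ n) => e x y w b d e0 h1.
  transitivity (e ^+ 2 * (b / e * x + (- d ^+ 2 - z / e ^+ 2) * y + d * e / e * w)).
    by field; exact: e0.
  by rewrite h1 mulr0.
- by exists B => k; exact: hB.
- by exists B => k; exact: hB.
Qed.

(** The eigensequence for the eigenvalue 1: it satisfies a first order
    recurrence, being annihilated by one of the bidiagonal factors of 1 - J. *)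
(** * Bounded eigensequences *)

Definition ground (k : int) : R := Num.sqrt t ^ k * Num.sqrt s ^ (k * (k + 1)).

Lemma ground_next k : ground k = A k * ground (k + 1).
Proof.
have h1 : Num.sqrt t != 0 by rewrite gt_eqF // sqrtr_gt0.
have h2 : Num.sqrt s != 0 by rewrite gt_eqF // sqrtr_gt0 s_gt0.
rewrite coef_aE /ground [Num.sqrt t ^ (k + 1)]expfzDr // [Num.sqrt t ^ 1]expr1z.
have -> : (k + 1) * (k + 1 + 1) = k * (k + 1) + 2%:Z * (k + 1) by ring.
rewrite [Num.sqrt s ^ (_ + _)]expfzDr // -[Num.sqrt s ^ (2%:Z * _)]exprz_exp.
rewrite -exprnP sqr_sqrtr; last by rewrite ltW // s_gt0.
have h3 : s ^ (k + 1) != 0 by rewrite expfz_neq0 // s_neq0.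
by field; rewrite h1 h3.
Qed.

Lemma ground_gt0 k : 0 < ground k.
Proof. by rewrite mulr_gt0 // exprz_gt0 // sqrtr_gt0 // s_gt0. Qed.

Lemma bounded_eigenvalue1 : bounded_eigenvalue 1.
Proof.
have ng k : normc (ground k)%:C = ground k.
  by rewrite normc_real ger0_norm // ltW // ground_gt0.
exists (fun k => (ground k)%:C), 0; split.
- move=> k; rewrite /tridiag diagE /a [ground k]ground_next.
  have -> : ground (k - 1) = A (k - 1) * (A k * ground (k + 1)).
    by rewrite [LHS]ground_next subrK [ground k]ground_next.
  by rewrite !rmorphM /=; ring.
- have [K hK] := coef_a_large 1.
  apply: (@bounded_of_eventually_bounded _ _ (ground K) K) => n Kn.
  rewrite ng; apply: (@int_nonincreasing R ground K n); last by lia.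
  move=> k hk; rewrite [leRHS]ground_next; apply: ler_peMl.
    by rewrite ltW // ground_gt0.
  by apply: hK; lia.
- have [K hK] := coef_a_small ltr01.
  apply: (@bounded_of_eventually_bounded _ _ (ground (- K%:Z)) K) => n Kn.
  rewrite ng -lerN2; apply: (@int_nonincreasing R (fun k => - ground k) (- n%:Z) (-
    K%:Z)); last by lia.
  move=> k hk; rewrite lerN2 [leLHS]ground_next; apply: ler_piMl.
    by rewrite ltW // ground_gt0.
  by apply: hK; lia.
by rewrite -normc_eq0 ng gt_eqF // ground_gt0.
Qed.

Lemma bounded_eigenvalue_pow n : bounded_eigenvalue (q ^+ n)%:C.
Proof.
elim: n => [|n IH]; first by rewrite expr0; exact: bounded_eigenvalue1.
rewrite exprS rmorphM; apply: bounded_eigenvalue_raise IH.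
rewrite -rmorphM -exprS -(rmorph1 (real_complex R)).
apply/eqP => /(@complexI R) h.
by have := @exprn_ilt1 R n.+1 q (ltW q_gt0) q_lt1; rewrite h ltxx.
Qed.

(** When z is a diagonal entry, the coefficient of v p in the equation at p
    vanishes, and the equations at p + j and p - j are mirror images of each
    other up to powers of s. *)
Lemma kernel_symmetry (p : int) v : kernel a (diag (coef_b q t p)%:C) v ->
  forall j, v (p - j%:Z) = (- sg^-1) ^+ j * v (p + j%:Z).
Proof.
move=> hv; set z := (coef_b q t p)%:C in hv.
have zE : z = - (sg * a p) ^+ 2.
  by rewrite -offdiag_prev -[RHS]subr0 -diagE /diag subr0.
have s0 := sg_neq0.
suff h j : v (p - j%:Z) = (- sg^-1) ^+ j * v (p + j%:Z) /\
    v (p - j.+1%:Z) = (- sg^-1) ^+ j.+1 * v (p + j.+1%:Z).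
  by move=> j; exact: (h j).1.
elim: j => [|j [IH1 IH2]].
  split; first by rewrite expr0 mul1r; congr v; lia.
  have d0 : diag z p = 0 by rewrite /diag subrr.
  have := hv p; rewrite /tridiag d0 mul0r addr0 offdiag_prev expr1 => h.
  apply: (mulfI (offdiag_neq0 p)); apply: (mulfI s0).
  apply/eqP; rewrite -subr_eq0 -h; apply/eqP.
  by field; exact: s0.
split=> //.
pose m : int := j.+1%:Z.
have hp := hv (p + m); have hm := hv (p - m).
have sm : sg ^+ j.+1 != 0 by rewrite expf_neq0.
have ap : a (p + m) = a p / sg ^+ j.+1 by rewrite -(offdiag_shift p j.+1) mulfK.
have am : a (p - m) = a p * sg ^+ j.+1 by rewrite -(offdiag_shift (p - m) j.+1) subrK.
move: hp hm; rewrite /tridiag !diagE !offdiag_prev ap am zE.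
have -> : p + m + 1 = p + j.+2%:Z by rewrite /m; lia.
have -> : p + m - 1 = p + j%:Z by rewrite /m; lia.
have -> : p - m - 1 = p - j.+2%:Z by rewrite /m; lia.
have -> : p - m + 1 = p - j%:Z by rewrite /m; lia.
rewrite IH1 IH2 !(exprS _ j.+1) !(exprS (- sg^-1) j) -/m.
move: (offdiag_neq0 p) sm; move: (a p) (sg ^+ j.+1) ((- sg^-1) ^+ j) => y e d y0 e0.
move: (v (p + m)) (v (p + j.+2%:Z)) (v (p + j%:Z)) (v (p - j.+2%:Z))
  => V1 V2 V0 X hp hm.
apply: (mulfI (mulf_neq0 s0 (mulf_neq0 y0 e0))).
apply/eqP; rewrite -subr_eq0; apply/eqP.
rewrite -[RHS](subrr 0) -{1}hm -[X in _ = _ - X](mulr0 (d * e ^+ 2 / sg)) -hp.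
by field; rewrite s0 e0.
Qed.

Lemma coef_b_neq0 p : (coef_b q t p)%:C != 0 :> C.
Proof.
rewrite -normc_eq0 normc_real normr_eq0 coef_bE oppr_eq0.
by rewrite gt_eqF // exprn_gt0 // coef_a_gt0.
Qed.

(** The solution bounded at +oo decays faster there than s ^ j, so its mirror
    image, multiplied by s ^ - j, stays bounded at -oo. *)
Lemma bounded_eigenvalue_coef_b p : bounded_eigenvalue (coef_b q t p)%:C.
Proof.
have [v [m [hv bR vm]]] := exists_bounded_right offdiag_neq0 (dominant_right (coef_b
  q t p)%:C).
exists v, m; split=> //; last by rewrite vm oner_neq0.
have [K1 h1] := bounded_right_fast hv bR; have [K2 h2] := coef_a_large (4 / s).
have s0 := s_gt0; have si : 0 < s^-1 by rewrite invr_gt0.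
pose u k := s^-1 ^ k * normc (v (p + k)).
have [B hB] : exists B, forall n, u n%:Z <= B.
  pose K := (K1 + K2 + `|p|)%N.
  apply: (@bounded_of_eventually_bounded _ _ (u K%:Z) K) => n Kn.
  apply: (@int_nonincreasing R u K n); last by lia.
  move=> k hk; rewrite /u expfzDr ?invr_eq0 ?s_neq0 // expr1z -mulrA.
  rewrite ler_wpM2l ?exprz_ge0 ?(ltW si) //.
  have e1 := h1 (p + k) ltac:(rewrite /K in hk; lia).
  have e2 := h2 (p + k) ltac:(rewrite /K in hk; lia).
  rewrite addrA; have := le_trans (ler_wpM2r (normc_ge0 (v (p + k + 1))) e2) e1.
  lra.
apply: (@bounded_of_eventually_bounded _ _ B `|p|) => n pn.
have nc j : normc ((- sg^-1) ^+ j) = s^-1 ^+ j.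
  elim: j => [|j IH]; first by rewrite !expr0 Normc.normc1.
  by rewrite !exprS Normc.normcM IH normcN Normc.normcV normc_real ger0_norm // ltW.
have := hB (absz (p + n%:Z)); rewrite /u -exprnP -nc -Normc.normcM.
rewrite -(kernel_symmetry hv).
by have -> : p - (absz (p + n%:Z))%:Z = - n%:Z by lia.
Qed.

(** Near -oo the equation for z = 0 is close to v (k - 1) = - v (k + 1) / s,
    whose solutions grow at the rate c = s ^ (- 1 / 2) per step in the norm
    |v k| + c |v (k + 1)|. As A k tends to 0, the perturbation leaves a growth
    by any smaller factor, here theta. *)
Lemma kernel0_bounded_left_eq0 v : kernel a (diag 0) v -> bounded_left v -> forall k,
  v k = 0.
Proof.
move=> hv [B hB].
have s0 := s_gt0; have s1 := s_lt1.
pose c := (Num.sqrt s)^-1.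
have r0 : 0 < Num.sqrt s by rewrite sqrtr_gt0.
have r1 : Num.sqrt s < 1 by rewrite -[ltRHS]sqrtr1 ltr_sqrt.
have c1 : 1 < c by rewrite invf_gt1.
have c2 : s^-1 = c ^+ 2 by rewrite /c exprVn sqr_sqrtr // ltW.
pose theta := (c + 1) / 2.
have [K hK] := @coef_a_small ((c - 1) / 2) ltac:(lra).
pose N k := normc (v k) + c * normc (v (k + 1)).
have stepN k : k <= - K%:Z -> theta * N k <= N (k - 1).
  move=> kK; have hA := hK (k - 1) ltac:(lia); rewrite /N subrK.
  have e : v (k - 1) = - (sg^-1 * v (k + 1) - a (k - 1) * v k).
    have := hv k; rewrite /tridiag diagE subr0.
    have -> : a k = a (k - 1) / sg by rewrite -offdiag_next subrK.
    move: (offdiag_neq0 (k - 1)); move: (a (k - 1)) => y y0 h.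
    apply: (mulfI y0); apply/eqP; rewrite -subr_eq0 -h; apply/eqP.
    by field; rewrite sg_neq0.
  have h1 : c ^+ 2 * normc (v (k + 1)) - A (k - 1) * normc (v k) <= normc (v (k - 1)).
    rewrite e normcN; apply: le_trans (ler_normc_dist _ _).
    by rewrite !Normc.normcM Normc.normcV normc_offdiag normc_real ger0_norm ?c2.
  have V0 := normc_ge0 (v k); have V1 := normc_ge0 (v (k + 1)).
  have h2 := ler_wpM2r V0 hA.
  have h3 : 0 <= (c - 1) * c * normc (v (k + 1)) by rewrite !mulr_ge0 //; lra.
  rewrite /theta; rewrite expr2 in h1; lra.
have growN n : theta ^+ n * N (- K%:Z) <= N (- K%:Z - n%:Z).
  elim: n => [|n IH]; first by rewrite expr0 mul1r subr0.
  rewrite exprS -mulrA; have -> : - K%:Z - n.+1%:Z = - K%:Z - n%:Z - 1 by lia.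
  apply: le_trans (stepN _ _); last by lia.
  by rewrite ler_wpM2l // /theta; lra.
have theta1 : 1 < theta by rewrite /theta; lra.
have NK : N (- K%:Z) <= 0.
  apply: (@le0_of_pow _ theta^-1 _ ((1 + c) * B) 1%N).
    have theta0 : 0 < theta := lt_trans ltr01 theta1.
    by rewrite invr_ge0 ltW //= invf_lt1.
  move=> n n1; rewrite exprVn ler_pdivlMr ?exprn_gt0 //; last lra.
  rewrite mulrC; apply: le_trans (growN n) _; rewrite /N mulrDl mul1r.
  apply: lerD.
    by have := hB (K + n)%N; have -> : - (K + n)%N%:Z = - K%:Z - n%:Z by lia.
  rewrite ler_wpM2l ?(ltW (lt_trans ltr01 c1)) //.
  have := hB (K + n.-1)%N; have -> : - (K + n.-1)%N%:Z = - K%:Z - n%:Z + 1 by lia.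
  done.
have V0 := normc_ge0 (v (- K%:Z)); have V1 := normc_ge0 (v (- K%:Z + 1)).
have hc : 0 <= (c - 1) * normc (v (- K%:Z + 1)) by rewrite mulr_ge0 //; lra.
rewrite /N in NK.
apply: (kernel_unique offdiag_neq0 hv (m := - K%:Z)).
  by apply/eqP; rewrite -normc_eq0; apply/eqP; lra.
by apply/eqP; rewrite -normc_eq0; apply/eqP; lra.
Qed.

End Coefficients.

(** * The spectrum *)

Section Spectrum.
Variable R : realType.
Local Notation normc := (@Normc.normc R).
Variables q t : R.
Hypotheses (q_gt0 : 0 < q) (q_lt1 : q < 1) (t_gt0 : 0 < t).
Local Notation Jstar := (adjoint (jacobi (coef_a q t) (coef_b q t))).

Lemma bounded_eigenvalue_ell2 z : z != 0 -> bounded_eigenvalue q t z ->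
  exists v m, [/\ kernel (offdiag q t) (diag q t z) v, ell2 v & v m != 0].
Proof.
move=> z0 [v [m [hv bR bL vm]]]; exists v, m; split=> //.
by apply: (ell2_of_bounded_kernel _ _ _ hv bR bL);
  [exact: offdiag_neq0|exact: dominant_right|exact: dominant_left].
Qed.

Lemma spectrum_of_bounded_eigenvalue z : z != 0 -> bounded_eigenvalue q t z ->
  spectrum Jstar z.
Proof.
by move=> z0 /(bounded_eigenvalue_ell2 z0)[v [m [hv lv vm]]]; exact:
  mem_spectrum_of_kernel vm hv.
Qed.

Lemma pow_neq0 n : (q ^+ n)%:C != 0 :> R[i].
Proof. by rewrite -normc_eq0 normc_real normr_eq0 expf_neq0 // gt_eqF. Qed.

Lemma pow_mem_spectrum n : spectrum Jstar (q ^+ n)%:C.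
Proof.
apply: spectrum_of_bounded_eigenvalue; first exact: pow_neq0.
exact: bounded_eigenvalue_pow.
Qed.

Lemma coef_b_mem_spectrum p : spectrum Jstar (coef_b q t p)%:C.
Proof.
apply: spectrum_of_bounded_eigenvalue; first exact: coef_b_neq0.
exact: bounded_eigenvalue_coef_b.
Qed.

(** A unit eigenvector for the small eigenvalue q ^ n is almost annihilated, which
    prevents the inverse at 0 from being bounded. *)
Lemma zero_mem_spectrum : spectrum Jstar 0.
Proof.
move=> [_ [M hM]].
have q01 : 0 <= q < 1 by rewrite ltW.
have M1 : 0 < (`|M| + 1)^-1 by rewrite invr_gt0 ltr_wpDl.
have [n hn] := pow_small q01 M1.
have qn : 0 < q ^+ n by rewrite exprn_gt0.
have [v [m [hv lv vm]]] := bounded_eigenvalue_ell2 (pow_neq0 n)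
  (bounded_eigenvalue_pow q_gt0 q_lt1 t_gt0 n).
pose f : int -> R[i] := fun k => (q ^+ n)%:C * v k.
have nf N : window_norm f N <= (q ^+ n * ell2norm v) ^+ 2.
  rewrite exprMn; apply: le_trans (ler_wpM2l (sqr_ge0 _) (window_norm_le N lv)).
  rewrite /window_norm mulr_sumr; apply: ler_sum => k _.
  by rewrite /f Normc.normcM normc_real exprMn real_normK ?num_real.
have lf : ell2 f := ell2_of_window_norm nf.
have Lf : ell2norm f <= q ^+ n * ell2norm v.
  by apply: ell2norm_le nf; rewrite mulr_ge0 ?ell2norm_ge0 // ltW.
have vf : Jstar (v, 0 *: v + f).
  apply/(adjoint_jacobi_shiftP _ _ _ _ lf); split=> // k.
  have := hv k; rewrite /tridiag /diag /offdiag subr0 /f => e.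
  by apply/eqP; rewrite -subr_eq0 -e; apply/eqP; ring.
have h := hM v f lf vf.
have vp : 0 < ell2norm v by apply: lt_le_trans (ell2norm_ge m lv); rewrite normc_gt0.
have M0 := ler_norm M; have M2 := normr_ge0 M.
have h1 : M * ell2norm f <= `|M| * (q ^+ n * ell2norm v).
  apply: (@le_trans _ _ (`|M| * ell2norm f)); last by rewrite ler_wpM2l.
  by rewrite ler_wpM2r // ell2norm_ge0.
have h2 : q ^+ n * (`|M| + 1) < 1.
  by move: hn; rewrite -[X in _ < X]mul1r ltr_pdivlMr // ltr_wpDl.
have h3 : (`|M| * q ^+ n) * ell2norm v < 1 * ell2norm v.
  by rewrite ltr_pM2r //; lra.
lra.
Qed.

Lemma resolvent_of_other z : z != 0 -> (forall k, diag q t z k != 0) ->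
  (forall n : nat, z != (q ^+ n)%:C) -> resolvent_set Jstar z.
Proof.
move=> z0 d0 zn; apply: mem_resolvent_set.
- by move=> k; rewrite gt_eqF // coef_a_gt0.
- exact: dominant_right.
- exact: dominant_left.
move=> v hv bR bL k; apply/eqP; apply/negPn/negP => vk.
apply: (@not_bounded_eigenvalue R q t q_gt0 q_lt1 t_gt0 z z0 d0 zn).
by exists v, k.
Qed.

Lemma zero_not_eigenvalue : ~ point_spectrum Jstar 0.
Proof.
move=> [v v0 /adjoint_jacobiP[lv _ h]]; apply: v0; apply/funext => k.
apply: (kernel0_bounded_left_eq0 q_gt0 q_lt1 t_gt0 _ (ell2_bounded lv).2) => j.
have := h j; rewrite /tridiag /diag subr0 /offdiag => ->.
by rewrite scale0r.
Qed.

End Spectrum.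

Theorem theorem3p3 (R : realType) (q t : R)
  (q_gt0 : 0 < q) (q_lt1 : q < 1) (t_gt0 : 0 < t) :
  let Jstar := adjoint (jacobi (coef_a q t) (coef_b q t)) in
  [/\ spectrum Jstar =
        [set (- (q ^ r / t))%:C | r in [set: int]] `|` [set 0] `|`
        [set (q ^+ n)%:C | n in [set: nat]],
      limit_point (spectrum Jstar : set R[i]^o) 0
    & ~ point_spectrum Jstar 0].
Proof.
move=> Jstar.
have bE (r : int) : coef_b q t (- r) = - (q ^ r / t).
  by rewrite /coef_b invfM -invr_expz invrK mulrC.
split; last exact: zero_not_eigenvalue.
  apply/seteqP; split=> [z zs|z].
    apply/not_notP => h; apply: zs; apply: resolvent_of_other => //.
    - by apply/eqP => e; apply: h; left; right.
    - move=> k; rewrite /diag subr_eq0; apply/eqP => e; apply: h; left; left.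
      by exists (- k) => //; rewrite -bE opprK.
    - by move=> n; apply/eqP => e; apply: h; right; exists n.
  move=> [[[r _ <-]|->]|[n _ <-]].
  - by rewrite -bE; exact: coef_b_mem_spectrum.
  - exact: zero_mem_spectrum.
  - exact: pow_mem_spectrum.
move=> U /nbhs_ballP[e /= e0 eU].
have eR : e = (complex.Re e)%:C by rewrite RRe_real // gtr0_real.
have er : 0 < complex.Re e by rewrite -ltcR -eR.
have q01 : 0 <= q < 1 by rewrite ltW.
have [n hn] := pow_small q01 er.
exists (q ^+ n)%:C; split; [exact: pow_neq0|exact: pow_mem_spectrum|].
apply: eU; rewrite /ball /= sub0r normrN normc_def /= expr0n addr0 sqrtr_sqr.
by rewrite eR ltcR ger0_norm // exprn_ge0 // ltW.
Qed.
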